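(* Let $\mathcal K=\mathcal K_1\times\cdots\times\mathcal K_J$ be a product of second-order cones $\mathcal K_i\subset\mathbb{R}^{m_i}$, $m=\sum_{i=1}^Jm_i$, and let $g:\mathbb{R}^n\to\mathbb{R}^p$, $h:\mathbb{R}^n\to\mathbb{R}^q$, $\phi,\psi:\mathbb{R}^n\to\mathbb{R}^s$, $G=(G_1,\dots,G_J),H=(H_1,\dots,H_J):\mathbb{R}^n\to\mathbb{R}^m$ (with $G_i,H_i:\mathbb{R}^n\to\mathbb{R}^{m_i}$) be continuously differentiable. Let $\mathcal F$ be the solution set of the system $$\mathcal K\ni G(z)\perp H(z)\in\mathcal K,\qquad g(z)\le0,\ h(z)=0,\ 0\le\phi(z)\perp\psi(z)\ge0,$$ and let $z^*\in\mathcal F$. Suppose that the complementarity system $g(z)\le0,\ h(z)=0,\ 0\le\phi(z)\perp\psi(z)\ge0$ is metrically subregular at $(z^*,0)$. Further assume that either $\mathcal L(z^* )=\{0\}$, or $\mathcal L(z^* )\neq\{0\}$ and for every $0\neq w\in\mathcal L(z^* )$ one has $$\left.\begin{array}{l}\nabla g(z^* )^T\lambda^g+\nabla h(z^* )^T\lambda^h+\nabla\phi(z^* )^T\lambda^\phi+\nabla\psi(z^* )^T\lambda^\psi+\nabla G(z^* )^T\lambda^G+\nabla H(z^* )^T\lambda^H=0,\\ \lambda^g\ge0,\ \lambda_i^g=0\ \forall i\notin I_g,\ \lambda_i^\phi=0\ \forall i\notin I_\phi,\ \lambda_i^\psi=0\ \forall i\notin I_\psi,\\ (\lambda_i^\phi,\lambda_i^\psi)\in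 N_\Theta(\nabla\phi_i(z^* )w,\nabla\psi_i(z^* )w)\ \forall i\in I_\phi\cap I_\psi,\\ (\lambda_i^G,\lambda_i^H)\in N_{\Omega_i}\big((G_i(z^* ),H_i(z^* ));(\nabla G_i(z^* )w,\nabla H_i(z^* )w)\big)\ \forall i=1,\dots,J\end{array}\right\}\Longrightarrow(\lambda^G,\lambda^H)=0.$$ Then the system has a local error bound at $z^*$; that is, there exist constants $\kappa>0$ and $\delta>0$ such that for all $z\in B_\delta(z^* )$, $$d(z,\mathcal F)\le\kappa\Big\{\|h(z)\|+\|g_+(z)\|+\sum_{i=1}^sd_\Theta(\phi_i(z),\psi_i(z))+\sum_{i=1}^Jd_{\Omega_i}(G_i(z),H_i(z))\Big\}.$$
   Context: $\mathcal K_i=\{(x_1,x_2)\in\mathbb{R}\times\mathbb{R}^{m_i-1}:x_1\ge\|x_2\|\}$ ($=\mathbb{R}_+$ if $m_i=1$); $\Omega_i=\{(x,y)\in\mathbb{R}^{m_i}\times\mathbb{R}^{m_i}:\mathcal K_i\ni x\perp y\in\mathcal K_i\}$; $\lambda^G=(\lambda_1^G,\dots,\lambda_J^G)$, $\lambda^H=(\lambda_1^H,\dots,\lambda_J^H)$. $\nabla$ is the Jacobian; $d_C(z)=d(z,C)$ is Euclidean distance; $B_\delta(z^* )$ the open ball; $g_+(z)=\max\{0,g(z)\}$ componentwise. For a map $\varphi$, $I_\varphi=\{i:\varphi_i(z^* )=0\}$ and $I_\varphi^c$ is its complement. $\Theta=\{(a,b)\in\mathbb{R}^2:a\ge0,\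 b\ge0,\ ab=0\}$ and $\Theta^s=\{(a,b)\in\mathbb{R}^{2s}:a\ge0,\ b\ge0,\ a^Tb=0\}$. For $(x,y)\in\Theta$, the limiting normal cone $N_\Theta(x,y)$ is the set of $(u,v)\in\mathbb{R}^2$ such that $u=0$ if $x>0$; $v=0$ if $y>0$; and either ($u<0$ and $v<0$) or $uv=0$, if $x=y=0$. The complementarity system being metrically subregular at $(z^*,0)$ means that the set-valued map $M(z)=(g(z),h(z),\phi(z),\psi(z))-\mathbb{R}^p_-\times\{0\}^q\times\Theta^s$ is metrically subregular at $(z^*,0)$: there are a neighborhood $V$ of $z^*$ and $\kappa>0$ with $d(z,S)\le\kappa\,d\big((g(z),h(z),\phi(z),\psi(z)),\mathbb{R}^p_-\times\{0\}^q\times\Theta^s\big)$ for all $z\in V$, where $S$ is the solution set of the complementarity system. The linearized cone $\mathcal L(z^* )$ is the set of $w\in\mathbb{R}^n$ satisfying: $\nabla g_i(z^* )w\le0$ for $i\in I_g$; $\nabla h_i(z^* )w=0$ for $i=1,\dots,q$; $\nabla\phi_i(z^* )w=0$ for $i\in I_\psi^c$; $\nabla\psi_i(z^* )w=0$ for $i\in I_\phi^c$; $0\le\nabla\phi_i(z^* )w\perp\nabla\psi_i(z^* )w\ge0$ for $i\in I_\phi\cap I_\psi$; $(\nabla G_i(z^* )w,\nabla H_i(z^* )w)\in T_{\Omega_i}(G_i(z^* ),H_i(z^* ))$ for $i=1,\dots,J$. For $C\subseteq\mathbb{R}^n$, $z\in C$: $T_C(z)=\{u:\exists t_k\downarrow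 0,\ u_k\to u \text{ with } z+t_ku_k\in C\ \forall k\}$; regular normal cone $\widehat N_C(z)=\{v:\langle v,z'-z\rangle\le o(\|z'-z\|)\ \forall z'\in C\}$ for $z\in C$ and $\emptyset$ for $z\notin C$; directional limiting normal cone $N_C(z;d)=\{v:\exists t_k\downarrow0,\ d_k\to d,\ v_k\to v\text{ with }v_k\in\widehat N_C(z+t_kd_k)\ \forall k\}$. *)

(* Defs.v *)
From HB Require Import structures.
From mathcomp Require Import all_boot all_order all_algebra.
From mathcomp Require Import all_classical all_reals all_analysis.

Set Implicit Arguments.
Unset Strict Implicit.
Unset Printing Implicit Defensive.

Import Order.TTheory GRing.Theory Num.Theory.
Import numFieldNormedType.Exports.

Local Open Scope classical_set_scope.
Local Open Scope ring_scope.

(* Vectors of R^N are row vectors 'rV[R]_N, and a point (x, y) of a product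
   R^M * R^N is row_mx x y : 'rV[R]_(M + N).  The library's norm `|_| on
   matrices is the sup norm, so the Euclidean structure is defined here; the
   topology (nbhs, convergence, differentiability) is the library's, which is
   the same for both norms.

   The library's Jacobian 'J f z of f : 'rV[R]_n -> 'rV[R]_r is n x r and acts
   on row vectors on the right: it is the transpose of the usual r x n Jacobian
   matrix (nabla f)(z).  Hence (nabla f)(z) w is w *m 'J f z, and
   (nabla f)(z)^T l is l *m ('J f z)^T. *)

Section Euclidean.
Context {R : realType}.

Definition dotv N (x y : 'rV[R]_N) : R := \sum_(j < N) x 0 j * y 0 j.

Definition enorm N (x : 'rV[R]_N) : R := Num.sqrt (dotv x x).

Definition eball N (x : 'rV[R]_N) (r : R) : set 'rV[R]_N :=
  [set y | enorm (y - x) < r].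

(* Only meaningful for nonempty C (the infimum of the empty set is 0). *)
Definition edistance N (z : 'rV[R]_N) (C : set 'rV[R]_N) : R :=
  inf [set enorm (z - c) | c in C].

Definition continuously_differentiable n r (f : 'rV[R]_n -> 'rV[R]_r) : Prop :=
  (forall z, differentiable f z) /\ continuous (fun z => 'J f z).

Definition posv N (x : 'rV[R]_N) : 'rV[R]_N := \row_j Num.max 0 (x 0 j).

End Euclidean.

Section Cones.
Context {R : realType} {N : nat}.
Implicit Types (C : set 'rV[R]_N) (z d u v : 'rV[R]_N).

Definition decreases_to0 (t : nat -> R) : Prop :=
  (forall k, 0 < t k) /\ t @ \oo --> (0 : R).

Definition tangent_cone C z : set 'rV[R]_N :=
  [set u | exists (t : nat -> R) (u_ : nat -> 'rV[R]_N),
     [/\ decreases_to0 t, u_ @ \oo --> u & forall k, C (z + t k *: u_ k)]].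

Definition regular_normal_cone C z : set 'rV[R]_N :=
  [set v | C z /\ forall e : R, 0 < e ->
     \forall z' \near z, C z' -> dotv v (z' - z) <= e * enorm (z' - z)].

Definition dir_normal_cone C z d : set 'rV[R]_N :=
  [set v | exists (t : nat -> R) (d_ v_ : nat -> 'rV[R]_N),
     [/\ decreases_to0 t, d_ @ \oo --> d, v_ @ \oo --> v &
         forall k, regular_normal_cone C (z + t k *: d_ k) (v_ k)]].

End Cones.

Section Complementarity.
Context {R : realType}.

(* The second-order cone in R^(k+1); for k = 0 the tail col' ord0 x is the empty
   vector, and the cone is R_+. *)
Definition soc k : set 'rV[R]_k.+1 := [set x | enorm (col' ord0 x) <= x 0 ord0].

Definition Omega k : set 'rV[R]_(k.+1 + k.+1) :=
  [set w | [/\ soc (lsubmx w), soc (rsubmx w) & dotv (lsubmx w) (rsubmx w) = 0]].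

Definition nonnegv N : set 'rV[R]_N := [set x | forall j, 0 <= x 0 j].

Definition nonposv N : set 'rV[R]_N := [set x | forall j, x 0 j <= 0].

Definition Theta s : set 'rV[R]_(s + s) :=
  [set w | [/\ nonnegv (lsubmx w), nonnegv (rsubmx w) &
               dotv (lsubmx w) (rsubmx w) = 0]].

(* The pair (a, b) as a point of R^2; Theta 1 is the planar set
   a >= 0, b >= 0, ab = 0. *)
Definition vec2 (a b : R) : 'rV[R]_(1 + 1) := row_mx a%:M b%:M.

(* Limiting normal cone to the planar set Theta 1 at (x, y). *)
Definition normal_Theta (x y : R) : set (R * R) :=
  [set uv | [/\ Theta (vec2 x y),
     0 < x -> uv.1 = 0,
     0 < y -> uv.2 = 0 &
     x = 0 -> y = 0 -> (uv.1 < 0 /\ uv.2 < 0) \/ uv.1 * uv.2 = 0]].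

Definition active n r (f : 'rV[R]_n -> 'rV[R]_r) (z : 'rV[R]_n) : set 'I_r :=
  [set i | f z 0 i = 0].

(* Metric subregularity at (z0, 0) of the set-valued map z |-> P z - D;
   P @^-1` D is the solution set of the inclusion P z \in D. *)
Definition metrically_subregular n N (P : 'rV[R]_n -> 'rV[R]_N)
    (D : set 'rV[R]_N) (z0 : 'rV[R]_n) : Prop :=
  exists2 kappa : R, 0 < kappa &
    \forall z \near z0, edistance z (P @^-1` D) <= kappa * edistance (P z) D.

Definition compl_map n p q s (g : 'rV[R]_n -> 'rV[R]_p)
    (h : 'rV[R]_n -> 'rV[R]_q) (phi psi : 'rV[R]_n -> 'rV[R]_s)
    (z : 'rV[R]_n) : 'rV[R]_(p + (q + (s + s))) :=
  row_mx (g z) (row_mx (h z) (row_mx (phi z) (psi z))).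

Definition compl_set p q s : set 'rV[R]_(p + (q + (s + s))) :=
  [set y | [/\ nonposv (lsubmx y), lsubmx (rsubmx y) = 0 &
               Theta (rsubmx (rsubmx y))]].

End Complementarity.

Section System.
Context {R : realType} (n p q s J : nat) (k : 'I_J -> nat).
Variables (g : 'rV[R]_n -> 'rV[R]_p) (h : 'rV[R]_n -> 'rV[R]_q).
Variables (phi psi : 'rV[R]_n -> 'rV[R]_s).
Variables (G H : forall i : 'I_J, 'rV[R]_n -> 'rV[R]_(k i).+1).

(* The inner product of G(z) and H(z) in the product space R^m is the sum of
   the inner products of the blocks. *)
Definition feasible_set : set 'rV[R]_n :=
  [set z | [/\ [/\ forall i, soc (G i z), forall i, soc (H i z) &
                   \sum_(i < J) dotv (G i z) (H i z) = 0],
               nonposv (g z), h z = 0 &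
               [/\ nonnegv (phi z), nonnegv (psi z) &
                   dotv (phi z) (psi z) = 0]]].

Definition linearized_cone (z : 'rV[R]_n) : set 'rV[R]_n :=
  [set w |
    [/\ forall i, active g z i -> (w *m 'J g z) 0 i <= 0,
        forall i, (w *m 'J h z) 0 i = 0,
        forall i, ~ active psi z i -> (w *m 'J phi z) 0 i = 0 &
        forall i, ~ active phi z i -> (w *m 'J psi z) 0 i = 0] /\
    [/\ forall i, active phi z i -> active psi z i ->
          [/\ 0 <= (w *m 'J phi z) 0 i, 0 <= (w *m 'J psi z) 0 i &
              (w *m 'J phi z) 0 i * (w *m 'J psi z) 0 i = 0] &
        forall i, tangent_cone (@Omega R (k i)) (row_mx (G i z) (H i z))
          (row_mx (w *m 'J (G i) z) (w *m 'J (H i) z))]].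

Definition dir_multiplier (z w : 'rV[R]_n) (lg : 'rV[R]_p) (lh : 'rV[R]_q)
    (lphi lpsi : 'rV[R]_s) (lG lH : forall i : 'I_J, 'rV[R]_(k i).+1) : Prop :=
  [/\ lg *m ('J g z)^T + lh *m ('J h z)^T
        + lphi *m ('J phi z)^T + lpsi *m ('J psi z)^T
        + \sum_(i < J) lG i *m ('J (G i) z)^T
        + \sum_(i < J) lH i *m ('J (H i) z)^T = 0,
      [/\ nonnegv lg,
          forall i, ~ active g z i -> lg 0 i = 0,
          forall i, ~ active phi z i -> lphi 0 i = 0 &
          forall i, ~ active psi z i -> lpsi 0 i = 0],
      forall i, active phi z i -> active psi z i ->
        normal_Theta ((w *m 'J phi z) 0 i) ((w *m 'J psi z) 0 i)
          (lphi 0 i, lpsi 0 i) &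
      forall i, dir_normal_cone (@Omega R (k i)) (row_mx (G i z) (H i z))
        (row_mx (w *m 'J (G i) z) (w *m 'J (H i) z)) (row_mx (lG i) (lH i))].

End System.

(* Main.v *)
(* Suppose that no error bound holds.  Projecting on the solution set S of the
   complementarity system, which is harmless by metric subregularity, gives
   s in S near z0 whose distances to the cone constraints sum to less than
   eps d(s, F).  Minimizing
     |(d(Q_i z, Omega_i))_i| + j d(P z, D)^2 + 2 eps |z - s|
   for j large yields z at distance less than d(s, F) / 2 from s, at which the
   Euclidean norm is positive, hence smooth; stationarity gives proximal
   normals lam to Omega_i of total length 1 and a proximal normal mu to D,
   bounded thanks to metric subregularity, such that
   P'(z)^T mu + Q'(z)^T lam = O(eps).  The squared penalty, rather than a
   distance to D, is what produces regular normals to the nonconvex set D at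
   nearby points.  The projections are o(|z - z0|)-close to P z and Q_i z, so
   that as eps tends to 0 the directions (z - z0) / |z - z0| accumulate at a
   nonzero w in the linearized cone and (mu, lam) at a directional multiplier
   with lam <> 0. *)

Require Import Defs.
From HB Require Import structures.
From mathcomp Require Import all_boot all_order all_algebra.
From mathcomp Require Import all_classical all_reals all_analysis.
From mathcomp Require Import ring lra.

Set Implicit Arguments.
Unset Strict Implicit.
Unset Printing Implicit Defensive.

Import Order.TTheory GRing.Theory Num.Theory.
Import numFieldNormedType.Exports.

Local Open Scope classical_set_scope.
Local Open Scope ring_scope.

(** * Euclidean geometry *)

Section EuclideanTheory.
Context {R : realType}.

(** The assumption excludes a nonzero [lam] only, so [lam] can be normalized whereas [mu] must be
    bounded separately. It has the form [2 j (P z - p)]. Comparing the penalized values at [z] and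
    at its projection [s'] on [S] gives [j |P z - p|^2 <= c |z - s'| <= c kap |P z - p|] with
    [c = J L + 2], and dividing by [|P z - p|] leaves a bound independent of [j]. Positivity of the
    norm at [z] comes from the choice of [j]. The closed ball of radius [d(s, F) / 2] around [s] has
    no feasible point, so the total residual has a positive minimum on it. Once [d(P z, D)] is below
    this minimum, the distances to the [Omega_i] cannot all vanish. The tilt [2 eps |z - s|]
    confines the minimizer to that ball. Since [z0] is feasible, this yields
    [d(s, F) <= 2 |z - z0|]: hence [z != z0], and projection errors of order [eps d(s, F)] are
    [o(|z - z0|)]. *)

Lemma ler_entry_norm m n (A : 'M[R]_(m, n)) i j : `|A i j| <= `|A|.
Proof.
have /mapP[k Hk ->] : `|A i j| \in [seq `|A k.1 k.2| | k : 'I_m * 'I_n].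
  by apply/mapP; exists (i, j) => //=; rewrite mem_enum.
by rewrite [leRHS]/Num.norm /= mx_normrE; apply/bigmax_geP; right => /=; exists k.
Qed.

Section Dot.
Context {N : nat}.
Implicit Types (x y z : 'rV[R]_N) (a : R).

Lemma dotvC x y : dotv x y = dotv y x.
Proof. by apply: eq_bigr => j _; rewrite mulrC. Qed.

Lemma dotvDl x y z : dotv (x + y) z = dotv x z + dotv y z.
Proof. by rewrite -big_split; apply: eq_bigr => j _; rewrite mxE mulrDl. Qed.

Lemma dotvZl a x y : dotv (a *: x) y = a * dotv x y.
Proof. by rewrite /dotv big_distrr; apply: eq_bigr => j _; rewrite /= mxE mulrA. Qed.

Lemma dotvNl x y : dotv (- x) y = - dotv x y.
Proof. by rewrite -scaleN1r dotvZl mulN1r. Qed.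

Lemma dotvBl x y z : dotv (x - y) z = dotv x z - dotv y z.
Proof. by rewrite dotvDl dotvNl. Qed.

Lemma dotvDr x y z : dotv x (y + z) = dotv x y + dotv x z.
Proof. by rewrite !(dotvC x) dotvDl. Qed.

Lemma dotvZr a x y : dotv x (a *: y) = a * dotv x y.
Proof. by rewrite !(dotvC x) dotvZl. Qed.

Lemma dotvNr x y : dotv x (- y) = - dotv x y.
Proof. by rewrite !(dotvC x) dotvNl. Qed.

Lemma dotvBr x y z : dotv x (y - z) = dotv x y - dotv x z.
Proof. by rewrite !(dotvC x) dotvBl. Qed.

Lemma dot0v x : dotv 0 x = 0.
Proof. by rewrite -(scale0r 0) dotvZl mul0r. Qed.

Lemma dotv0 x : dotv x 0 = 0.
Proof. by rewrite dotvC dot0v. Qed.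

Lemma dotv_suml (I : finType) (F : I -> 'rV[R]_N) x :
  dotv (\sum_i F i) x = \sum_i dotv (F i) x.
Proof.
apply: (big_morph (fun y => dotv y x)) => [y z|]; first exact: dotvDl.
exact: dot0v.
Qed.

Lemma dotv_sumr (I : finType) (F : I -> 'rV[R]_N) x :
  dotv x (\sum_i F i) = \sum_i dotv x (F i).
Proof. by rewrite dotvC dotv_suml; apply: eq_bigr => i _; rewrite dotvC. Qed.

Lemma dotv_delta x i : dotv x (delta_mx 0 i) = x 0 i.
Proof.
rewrite /dotv (bigD1 i)//= big1 ?addr0 => [|j ji].
  by rewrite mxE !eqxx mulr1.
by rewrite mxE (negbTE ji) andbF mulr0.
Qed.

Lemma dotv_mulmx_tr M (y : 'rV[R]_M) x (A : 'M[R]_(N, M)) :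
  dotv x (y *m A^T) = dotv (x *m A) y.
Proof.
have dotvE k (a b : 'rV[R]_k) : dotv a b = (a *m b^T) 0 0.
  by rewrite mxE; apply: eq_bigr => j _; rewrite mxE.
by rewrite !dotvE trmx_mul trmxK mulmxA.
Qed.

Lemma dotv_ge0 x : 0 <= dotv x x.
Proof. by apply: sumr_ge0 => j _; rewrite -expr2 sqr_ge0. Qed.

Lemma enorm_ge0 x : 0 <= enorm x.
Proof. exact: sqrtr_ge0. Qed.

Lemma sqr_enorm x : enorm x ^+ 2 = dotv x x.
Proof. by rewrite sqr_sqrtr ?dotv_ge0. Qed.

Lemma enorm_eq0 x : enorm x = 0 -> x = 0.
Proof.
move=> /(congr1 (fun a => a ^+ 2)); rewrite sqr_enorm expr0n/= => /eqP.
rewrite psumr_eq0 => [/allP x0|j _]; last by rewrite -expr2 sqr_ge0.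
apply/rowP => j; rewrite mxE; have := x0 j (mem_index_enum _).
by rewrite mulf_eq0 orbb => /eqP.
Qed.

Lemma enorm0 : enorm (0 : 'rV[R]_N) = 0.
Proof. by rewrite /enorm dot0v sqrtr0. Qed.

Lemma enorm_gt0 x : x != 0 -> 0 < enorm x.
Proof.
rewrite lt_def enorm_ge0 andbT; apply: contra => /eqP.
by move=> /enorm_eq0 xE; rewrite xE.
Qed.

Lemma enormZ a x : enorm (a *: x) = `|a| * enorm x.
Proof.
by rewrite /enorm dotvZl dotvZr mulrA -expr2 sqrtrM ?sqr_ge0// sqrtr_sqr.
Qed.

Lemma enormN x : enorm (- x) = enorm x.
Proof. by rewrite -scaleN1r enormZ normrN1 mul1r. Qed.

Lemma enormB x y : enorm (x - y) = enorm (y - x).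
Proof. by rewrite -enormN opprB. Qed.

Lemma sqr_enormD x y :
  enorm (x + y) ^+ 2 = enorm x ^+ 2 + 2 * dotv x y + enorm y ^+ 2.
Proof. by rewrite !sqr_enorm dotvDl !dotvDr (dotvC y x); ring. Qed.

Lemma sqr_enormB x y :
  enorm (x - y) ^+ 2 = enorm x ^+ 2 - 2 * dotv x y + enorm y ^+ 2.
Proof. by rewrite sqr_enormD dotvNr enormN mulrN. Qed.

(** Expanding [|b x - a y|^2 >= 0] with [a = |x|] and [b = |y|] gives [2 a b (a b - <x, y>) >= 0],
    and [a b > 0] outside the trivial cases. *)
Lemma dotv_le_enorm x y : dotv x y <= enorm x * enorm y.
Proof.
have [->|x0] := eqVneq x 0; first by rewrite dot0v enorm0 mul0r.
have [->|y0] := eqVneq y 0; first by rewrite dotv0 enorm0 mulr0.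
have : 0 <= dotv (enorm y *: x - enorm x *: y) (enorm y *: x - enorm x *: y).
  exact: dotv_ge0.
rewrite !(dotvBl, dotvBr, dotvZl, dotvZr) -!sqr_enorm (dotvC y x).
have := mulr_gt0 (enorm_gt0 x0) (enorm_gt0 y0).
set a := enorm x; set b := enorm y; set d := dotv x y => ab H.
rewrite -subr_ge0 -(pmulr_rge0 _ ab); lra.
Qed.

Lemma ler_norm_dotv x y : `|dotv x y| <= enorm x * enorm y.
Proof.
rewrite ler_norml dotv_le_enorm andbT lerNl -dotvNl -(enormN x).
exact: dotv_le_enorm.
Qed.

Lemma enormD x y : enorm (x + y) <= enorm x + enorm y.
Proof.
rewrite -(@ler_pXn2r _ 2) ?nnegrE ?addr_ge0 ?enorm_ge0//.
rewrite sqr_enorm dotvDl !dotvDr -!sqr_enorm (dotvC y x).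
have := dotv_le_enorm x y; lra.
Qed.

Lemma enorm_triangle x y z : enorm (x - z) <= enorm (x - y) + enorm (y - z).
Proof. by rewrite (le_trans _ (enormD _ _))// addrA subrK. Qed.

Lemma ler_enormB x y : enorm x - enorm y <= enorm (x - y).
Proof. by rewrite lerBlDr (le_trans _ (enormD _ _))// subrK. Qed.

Lemma ler_enorm_coord x j : `|x 0 j| <= enorm x.
Proof.
rewrite -(@ler_pXn2r _ 2) ?nnegrE ?enorm_ge0// sqr_enorm.
rewrite real_normK ?num_real// /dotv (bigD1 j)//= -expr2 lerDl sumr_ge0// => i _.
by rewrite -expr2 sqr_ge0.
Qed.

Lemma ler_norm_enorm x : `|x| <= enorm x.
Proof.
rewrite [leLHS]/Num.norm/=; have [->|/mx_norm_neq0 [[i j] ->]/=] := eqVneq (mx_norm x) 0.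
  exact: enorm_ge0.
by rewrite ord1 ler_enorm_coord.
Qed.

(** The crude constant [N.+1] is positive even when [N = 0], so radii can be divided by it. *)
Lemma ler_enorm_norm x : enorm x <= N.+1%:R * `|x|.
Proof.
rewrite -(@ler_pXn2r _ 2) ?nnegrE ?mulr_ge0 ?enorm_ge0// sqr_enorm exprMn.
apply: (@le_trans _ _ (\sum_(j < N) `|x| ^+ 2)).
  apply: ler_sum => j _; rewrite -expr2 -real_normK ?num_real//.
  by rewrite ler_pXn2r ?nnegrE// ler_entry_norm.
rewrite sumr_const card_ord -[leLHS]mulr_natl ler_wpM2r ?sqr_ge0// -natrX ler_nat.
by rewrite (leq_trans (leqnSn N))// leq_pmulr.
Qed.

(** Bridge between the two norms: the comparisons above make Euclidean balls a basis of the sup-norm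
    neighborhoods. *)
Lemma nbhs_enormP (P : set 'rV[R]_N) x :
  nbhs x P <-> exists2 r : R, 0 < r & forall y, enorm (y - x) < r -> P y.
Proof.
split=> [/nbhs_ballP[r /= r0 rP]|[r r0 rP]].
  exists r => // y yx; apply: rP; rewrite mx_norm_ball /ball_/= distrC.
  exact: le_lt_trans (ler_norm_enorm _) yx.
apply/nbhs_ballP; exists (r / N.+1%:R); first by rewrite /= divr_gt0.
move=> y; rewrite mx_norm_ball /ball_/= distrC ltr_pdivlMr// => yx.
by apply: rP; rewrite (le_lt_trans (ler_enorm_norm _))// mulrC.
Qed.

Lemma cvg_enormP (T : Type) (F : set_system T) {FF : Filter F}
    (f : T -> 'rV[R]_N) x :
  f @ F --> x <-> forall e : R, 0 < e -> \forall t \near F, enorm (f t - x) < e.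
Proof.
split=> [fx e e0|fx P /nbhs_enormP[r r0 rP]].
  by apply: (fx (fun y => enorm (y - x) < e)); apply/nbhs_enormP; exists e.
by rewrite /fmap/=; near do apply: rP; exact: fx.
Unshelve. all: by end_near. Qed.

End Dot.

(** * Entrywise limits of matrix expressions along a filter *)

Section Limits.
Context {T : Type} {F : set_system T} {FF : Filter F}.

Lemma cvg_mx m n (f : T -> 'M[R]_(m, n)) (A : 'M[R]_(m, n)) :
  (forall i j, f t i j @[t --> F] --> A i j) -> f @ F --> A.
Proof.
move=> fA; apply/cvg_ballP => e e0.
have {}fA i j : \forall t \near F, ball (A i j) e (f t i j) by move/cvg_ballP : (fA i j); exact.
have [I [D FI]] : exists I : T -> Prop, F I /\ forall t, I t -> forall i j, ball (A i j) e (f t i j).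
  exists (fun t => forall i j, ball (A i j) e (f t i j)); split => //.
  by apply: filter_forall => i; apply: filter_forall => j; exact: fA.
by near=> t; split => // i j; apply: FI; near: t.
Unshelve. all: by end_near. Qed.

Lemma cvg_coord m n (f : T -> 'M[R]_(m, n)) (A : 'M[R]_(m, n)) i j :
  f @ F --> A -> f t i j @[t --> F] --> A i j.
Proof. by move=> fA; exact: (cvg_comp _ _ fA (@coord_continuous _ _ _ i j A)). Qed.

Lemma cvg_mulmx m n p (f : T -> 'M[R]_(m, n)) (g : T -> 'M[R]_(n, p))
    (A : 'M[R]_(m, n)) (B : 'M[R]_(n, p)) :
  f @ F --> A -> g @ F --> B -> f t *m g t @[t --> F] --> A *m B.
Proof.
move=> fA gB; apply: cvg_mx => i j; rewrite mxE; under eq_cvg do rewrite mxE.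
apply: cvg_big => [|k _]; first exact: add_continuous.
by apply: cvgM; exact: cvg_coord.
Qed.

Lemma cvg_trmx m n (f : T -> 'M[R]_(m, n)) (A : 'M[R]_(m, n)) : f @ F --> A -> (f t)^T @[t --> F] --> A^T.
Proof.
move=> fA; apply: cvg_mx => i j; rewrite mxE; under eq_cvg do rewrite mxE.
exact: cvg_coord.
Qed.

Lemma cvg_row_mx m n p (f : T -> 'M[R]_(m, n)) (g : T -> 'M[R]_(m, p))
    (A : 'M[R]_(m, n)) (B : 'M[R]_(m, p)) :
  f @ F --> A -> g @ F --> B -> row_mx (f t) (g t) @[t --> F] --> row_mx A B.
Proof.
move=> fA gB; apply: cvg_mx => i j; rewrite mxE; under eq_cvg do rewrite mxE.
by case: (fintype.split j) => k; exact: cvg_coord.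
Qed.

Lemma cvg_dotv N (f g : T -> 'rV[R]_N) (x y : 'rV[R]_N) :
  f @ F --> x -> g @ F --> y -> dotv (f t) (g t) @[t --> F] --> dotv x y.
Proof.
move=> fx gy; apply: cvg_big => [|k _]; first exact: add_continuous.
by apply: cvgM; exact: cvg_coord.
Qed.

Lemma cvg_enorm N (f : T -> 'rV[R]_N) (x : 'rV[R]_N) :
  f @ F --> x -> enorm (f t) @[t --> F] --> enorm x.
Proof. by move=> fx; exact: (cvg_comp _ _ (cvg_dotv fx fx) (@sqrt_continuous _ _)). Qed.

End Limits.

(** * Distance to a set, projections and regular normals *)

Section Distance.
Context {N : nat}.
Implicit Types (x y z c : 'rV[R]_N) (C : set 'rV[R]_N).

Lemma edistance_le z C c : C c -> edistance z C <= enorm (z - c).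
Proof.
move=> Cc; apply: ge_inf; last by exists c.
by exists 0 => _ [y _ <-]; exact: enorm_ge0.
Qed.

Lemma edistance_ge z C e :
  C !=set0 -> (forall c, C c -> e <= enorm (z - c)) -> e <= edistance z C.
Proof.
move=> [c Cc] eC; apply: lb_le_inf; first by exists (enorm (z - c)), c.
by move=> _ [y Cy <-]; exact: eC.
Qed.

Lemma edistance_ge0 z C : 0 <= edistance z C.
Proof. 
have [->|/set0P[c Cc]] := eqVneq C set0; first by rewrite /edistance image_set0 inf0.
by apply: edistance_ge => [|y _]; [exists c|exact: enorm_ge0].
Qed.

Lemma edistance_lipschitz C y z :
  C !=set0 -> edistance y C <= edistance z C + enorm (y - z).
Proof.
move=> C0; rewrite -lerBlDr; apply: edistance_ge => // c Cc.
by rewrite lerBlDr addrC (le_trans (edistance_le _ Cc))// enorm_triangle.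
Qed.

Lemma edistance_dist C y z :
  C !=set0 -> `|edistance y C - edistance z C| <= enorm (y - z).
Proof.
move=> C0; rewrite ler_norml; apply/andP; split.
  by have := edistance_lipschitz z y C0; rewrite (enormB z y); lra.
by have := edistance_lipschitz y z C0; lra.
Qed.

Lemma edistance_continuous C : C !=set0 -> continuous (fun z => edistance z C).
Proof.
move=> C0 z; apply/(@cvgrPdist_lt _ _ _ (nbhs z) (nbhs_filter z)) => e e0; apply/nbhs_enormP; exists e => // y yz.
by rewrite (le_lt_trans (edistance_dist _ _ C0))// enormB.
Qed.

Definition cball x (r : R) : set 'rV[R]_N := [set y | enorm (y - x) <= r].

Lemma enormB_continuous x : continuous (fun y => enorm (y - x)).
Proof.
move=> y; apply: (@cvg_enorm _ (nbhs y) _ N (fun y => y - x)).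
by apply: cvgB; [exact: cvg_id|exact: cvg_cst].
Qed.

Lemma cball_compact x r : compact (cball x r).
Proof.
apply: bounded_closed_compact.
  exists (r + enorm x); split; first exact: num_real.
  move=> M rM y /= yx; rewrite (le_trans (ler_norm_enorm _))//.
  by rewrite (le_trans _ (ltW rM))// (le_trans _ (lerD yx (lexx _)))// -lerBlDr ler_enormB.
by have /continuous_closedP/(_ _ (@closed_le R r)) := enormB_continuous (x := x).
Qed.

Lemma continuous_min_compact (K : set 'rV[R]_N) (f : 'rV[R]_N -> R) :
  K !=set0 -> compact K -> continuous f ->
  exists2 c, K c & forall y, K y -> f c <= f y.
Proof.
move=> K0 cK cf; have [|c /set_mem Kc cP] := compact_EVT_min K0 cK (f := f).
  exact: continuous_subspaceT.
by exists c => // y Ky; apply: cP; exact: mem_set.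
Qed.

(** Only the points of [C] no farther from [z] than a given [c0] compete, and they form a compact
    set. *)
Lemma edistance_attained z C : closed C -> C !=set0 ->
  exists2 c, C c & edistance z C = enorm (z - c).
Proof.
move=> cC [c0 Cc0].
have z_cont : continuous (fun y => enorm (z - y)).
  rewrite (_ : (fun y => _) = fun y => enorm (y - z)); first exact: enormB_continuous.
  by apply/funext => y; rewrite enormB.
have K0 : (cball z (enorm (z - c0)) `&` C) !=set0.
  by exists c0; split => //; rewrite /cball/= enormB.
have [c [_ Cc] cP] := continuous_min_compact K0 (compact_closedI (@cball_compact z _) cC) z_cont.
exists c => //; apply/eqP; rewrite eq_le edistance_le//=.
apply: edistance_ge => [|y Cy]; first by exists c.
have [yz|/ltW zy] := leP (enorm (z - y)) (enorm (z - c0)).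
  by apply: cP; split => //; rewrite /cball/= (enormB y).
by rewrite (le_trans _ zy)// cP//; split => //; rewrite /cball/= (enormB c0).
Qed.

Lemma edistance0_mem z C : closed C -> C !=set0 -> edistance z C = 0 -> C z.
Proof.
move=> cC C0; have [c Cc ->] := edistance_attained z cC C0.
by move/enorm_eq0/eqP; rewrite subr_eq0 => /eqP ->.
Qed.

Lemma edistance_mem z C : C z -> edistance z C = 0.
Proof.
move=> Cz; apply/eqP; rewrite eq_le edistance_ge0 andbT.
by rewrite (le_trans (edistance_le _ Cz))// subrr enorm0.
Qed.

(** Proximal normals are regular: minimality of [c] bounds [<z - c, y - c>] by [|y - c|^2], and a
    quadratic bound, even scaled by [a], lies below [e |y - c|] as soon as
    [|y - c| < e / (a + 1)]. *)
Lemma regular_normal_projection C z c a :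
  C c -> edistance z C = enorm (z - c) -> 0 <= a ->
  regular_normal_cone C c (a *: (z - c)).
Proof.
move=> Cc zc a0; split => // e e0; apply/nbhs_enormP.
exists (e / (a + 1)); first by rewrite divr_gt0// ltr_wpDl.
move=> y; rewrite ltr_pdivlMr ?ltr_wpDl// => yc Cy.
have : enorm (z - c) ^+ 2 <= enorm (z - y) ^+ 2.
  by rewrite ler_pXn2r ?nnegrE ?enorm_ge0// -zc edistance_le.
rewrite (_ : z - y = (z - c) - (y - c)); last by rewrite opprB addrA subrK.
rewrite (sqr_enormB (z - c)) => le_zc; rewrite dotvZl.
have ? : dotv (z - c) (y - c) <= enorm (y - c) * enorm (y - c) by 
  by rewrite -expr2; have := sqr_ge0 (enorm (y - c)); lra.
have := enorm_ge0 (y - c); nra.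
Qed.

(** Dividing the defining inequality at [z + t u] by [t] leaves [<v, u> <= e |u|] for every
    [e > 0]. *)
Lemma regular_normal_dir C z v u r :
  regular_normal_cone C z v -> 0 < r ->
  (forall t, 0 < t < r -> C (z + t *: u)) -> dotv v u <= 0.
Proof.
move=> [_ vN] r0 Cu; rewrite leNgt; apply/negP => vu0.
(* A slope with [e |u| < <v, u>]; the [+ 1] keeps the denominator positive. *)
pose e := dotv v u / (2 * (enorm u + 1)).
have u1 : 0 < enorm u + 1 by rewrite ltr_wpDl// enorm_ge0.
have e0 : 0 < e by rewrite divr_gt0// mulr_gt0.
have /nbhs_enormP[d d0 dP] := vN e e0.
pose t := Num.min (r / 2) (d / (2 * (enorm u + 1))).
have t0 : 0 < t by rewrite lt_min !divr_gt0 ?mulr_gt0.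
have tr : t < r by rewrite (@le_lt_trans _ _ (r / 2)) ?ge_min ?lexx// ltr_pdivrMr//; lra.
have td : t * (2 * (enorm u + 1)) <= d.
  by rewrite -ler_pdivlMr ?mulr_gt0// ge_min lexx orbT.
have zt : z + t *: u - z = t *: u by rewrite addrAC subrr add0r.
have := dP (z + t *: u); rewrite zt enormZ gtr0_norm// dotvZr.
have -> : t * enorm u < d by nra.
move=> /(_ isT (Cu t _)); rewrite t0 tr => /(_ isT).
have -> : e * (t * enorm u) = t * dotv v u * (enorm u / (2 * (enorm u + 1))).
  by rewrite /e; field; lra.
rewrite leNgt => /negP; apply; rewrite gtr_pMr ?mulr_gt0// ltr_pdivrMr ?mulr_gt0//.
lra.
Qed.

End Distance.
End EuclideanTheory.

(** * Jacobians *)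

Section Jacobians.
Context {R : realType}.

Lemma ler_enorm_mulmx n N (u : 'rV[R]_n) (A : 'M[R]_(n, N)) :
  enorm (u *m A) <= N.+1%:R * n%:R * `|A| * enorm u.
Proof.
rewrite (le_trans (ler_enorm_norm _))// -!mulrA ler_wpM2l//.
rewrite [leLHS]/Num.norm/=; have [->|/mx_norm_neq0 [[i j] ->]/=] := eqVneq (mx_norm (u *m A)) 0.
  by rewrite !mulr_ge0// enorm_ge0.
rewrite mxE (le_trans (ler_norm_sum _ _ _))//.
apply: (@le_trans _ _ (\sum_(l < n) `|A| * enorm u)).
  apply: ler_sum => l _; rewrite normrM mulrC ler_pM// ?ler_entry_norm//.
  by rewrite ord1 ler_enorm_coord.
by rewrite sumr_const card_ord -[leLHS]mulr_natl.
Qed.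

(** First-order expansion in the Euclidean norm with an explicit matrix, so that the Jacobian of a
    stacked map is obtained by stacking matrices. *)
Definition has_jac n N (f : 'rV[R]_n -> 'rV[R]_N) (z : 'rV[R]_n) (A : 'M[R]_(n, N)) :=
  forall e : R, 0 < e -> exists2 r : R, 0 < r &
    forall u, enorm u < r -> enorm (f (z + u) - f z - u *m A) <= e * enorm u.

Lemma has_jac_jacobian n N (f : 'rV[R]_n -> 'rV[R]_N) z :
  differentiable f z -> has_jac f z ('J f z).
Proof.
move=> /diff_locally/eqaddoP df e e0.
have /df : 0 < e / N.+1%:R by rewrite divr_gt0.
move=> /nbhs_enormP[r r0 rP]; exists r => // u ur.
rewrite (le_trans (ler_enorm_norm _))// -ler_pdivlMl// mulrA (mulrC _ e).
have := rP u; rewrite subr0 => /(_ ur).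
rewrite /= !fctE/= opprD addrA (addrC u) => H; rewrite /jacobian mul_rV_lin1/=.
rewrite (le_trans H)// ler_wpM2l ?ler_norm_enorm//.
by rewrite divr_ge0// ltW.
Qed.

Lemma dotv_row_mx m n (a c : 'rV[R]_m) (b d : 'rV[R]_n) :
  dotv (row_mx a b) (row_mx c d) = dotv a c + dotv b d.
Proof.
rewrite /dotv big_split_ord/=; congr (_ + _); apply: eq_bigr => j _.
  by rewrite !row_mxEl.
by rewrite !row_mxEr.
Qed.

Lemma enorm_row_mx m n (a : 'rV[R]_m) (b : 'rV[R]_n) :
  enorm (row_mx a b) <= enorm a + enorm b.
Proof.
rewrite -(@ler_pXn2r _ 2) ?nnegrE ?addr_ge0 ?enorm_ge0//.
rewrite sqr_enorm dotv_row_mx -!sqr_enorm.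
have := mulr_ge0 (enorm_ge0 a) (enorm_ge0 b); lra.
Qed.

Lemma has_jac_row_mx n N M (f : 'rV[R]_n -> 'rV[R]_N) (g : 'rV[R]_n -> 'rV[R]_M) z A B :
  has_jac f z A -> has_jac g z B ->
  has_jac (fun z => row_mx (f z) (g z)) z (row_mx A B).
Proof.
move=> fA gB e e0; have e20 : 0 < e / 2 by rewrite divr_gt0.
have [r r0 rP] := fA _ e20; have [q q0 qP] := gB _ e20.
exists (Num.min r q) => [|u]; first by rewrite lt_min r0.
rewrite lt_min => /andP[ur uq].
rewrite mul_mx_row !opp_row_mx !add_row_mx (le_trans (enorm_row_mx _ _))//.
by have := rP _ ur; have := qP _ uq; lra.
Qed.

(** The quotient is [d k *m A] plus the remainder divided by [t k], at most [e |d k|], and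
    convergent directions are bounded. The direction varies with [k] because the points of the proof
    do not approach [z0] along a line. *)
Lemma has_jac_cvg n N (f : 'rV[R]_n -> 'rV[R]_N) z A (t : nat -> R)
    (d : nat -> 'rV[R]_n) (w : 'rV[R]_n) :
  has_jac f z A -> decreases_to0 t -> d @ \oo --> w ->
  (t k)^-1 *: (f (z + t k *: d k) - f z) @[k --> \oo] --> w *m A.
Proof.
move=> fA [t0 t_cvg] dw.
have dA : d k *m A @[k --> \oo] --> w *m A.
  by apply: (cvg_mulmx dw); exact: cvg_cst.
pose rest k := (t k)^-1 *: (f (z + t k *: d k) - f z - (t k *: d k) *m A).
have rest0 : rest @ \oo --> (0 : 'rV[R]_N).
  apply/cvg_enormP => e e0.
  have w1 : 0 < enorm w + 1 by rewrite ltr_wpDl// enorm_ge0.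
  have w2 : 0 < 2 * (enorm w + 1) by lra.
  have [r r0 rP] := fA _ (divr_gt0 e0 w2).
  have td0 : t k *: d k @[k --> \oo] --> (0 : 'rV[R]_n).
    by rewrite -(scale0r w); apply: cvgZ.
  have dw1 : \forall k \near \oo, enorm (d k) < enorm w + 1.
    move/cvg_enormP : dw => /(_ 1 ltr01); apply: filterS => k dk.
    by have := ler_enormB (d k) w; lra.
  near=> k.
  have : enorm (t k *: d k - 0) < r.
    by near: k; move/cvg_enormP : td0; exact.
  rewrite !subr0 => /rP; rewrite /rest !enormZ !gtr0_norm ?invr_gt0//.
  have dk : enorm (d k) < enorm w + 1 by near: k.
  move=> H; rewrite mulrC ltr_pdivrMr//.
  rewrite (le_lt_trans H)//.
  rewrite -subr_gt0 (_ : _ - _ = (e * t k) * ((2 * (enorm w + 1) - enorm (d k)) / (2 * (enorm w + 1)))); last by field; lra.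
  by apply: mulr_gt0; [exact: mulr_gt0|apply: divr_gt0; lra].
have quotE i : (t i)^-1 *: (f (z + t i *: d i) - f z) = rest i + d i *m A.
  by rewrite /rest [in RHS]scalerBr -scalemxAl scalerA mulVf ?gt_eqF// scale1r subrK.
rewrite (eq_cvg _ _ quotE).
by rewrite -[w *m A]add0r; apply: cvgD.
Unshelve. all: by end_near. Qed.

Definition C1_with n N (f : 'rV[R]_n -> 'rV[R]_N) (A : 'rV[R]_n -> 'M[R]_(n, N)) :=
  [/\ continuous f, continuous A & forall z, has_jac f z (A z)].

Lemma C1_with_jacobian n N (f : 'rV[R]_n -> 'rV[R]_N) :
  continuously_differentiable f -> C1_with f (fun z => 'J f z).
Proof.
move=> [df Jf]; split => // z; last exact: has_jac_jacobian.
exact: differentiable_continuous.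
Qed.

Lemma C1_with_row_mx n N M (f : 'rV[R]_n -> 'rV[R]_N) (g : 'rV[R]_n -> 'rV[R]_M) A B :
  C1_with f A -> C1_with g B ->
  C1_with (fun z => row_mx (f z) (g z)) (fun z => row_mx (A z) (B z)).
Proof.
move=> [cf cA fA] [cg cB gB]; split => z; last exact: has_jac_row_mx.
  by apply: (@cvg_row_mx _ _ (nbhs z)); [exact: cf|exact: cg].
by apply: (@cvg_row_mx _ _ (nbhs z)); [exact: cA|exact: cB].
Qed.

(** Pairing with a fixed [c] makes the real mean value theorem applicable to vector-valued maps. *)
Lemma has_jac_segment n N (f : 'rV[R]_n -> 'rV[R]_N) A z u c (t : R) :
  has_jac f (z + t *: u) A ->
  is_derive t 1 (fun t => dotv (f (z + t *: u)) c) (dotv (u *m A) c).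
Proof.
move=> fA.
suff H : h^-1 *: (dotv (f (z + (h *: 1 + t) *: u)) c - dotv (f (z + t *: u)) c)
    @[h --> 0^'] --> dotv (u *m A) c.
  by split; [exact: cvgP H|exact: cvg_lim H].
apply/cvgrPdist_le => e e0.
have k0 : 0 < (enorm u + 1) * (enorm c + 1).
  by rewrite mulr_gt0// ltr_wpDl// enorm_ge0.
have [r r0 rP] := fA (e / ((enorm u + 1) * (enorm c + 1))) (divr_gt0 e0 k0).
near=> h.
have h0 : h != 0 by near: h; exact: nbhs_dnbhs_neq.
have hr : enorm (h *: u) < r.
  rewrite enormZ (@le_lt_trans _ _ (`|h| * (enorm u + 1)))//.
    by rewrite ler_wpM2l// lerDl.
  rewrite -ltr_pdivlMr ?ltr_wpDl ?enorm_ge0//; near: h; apply: dnbhs0_lt.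
  by rewrite divr_gt0// ltr_wpDl// enorm_ge0.
have zh : z + (h *: 1 + t) *: u = z + t *: u + h *: u.
  by rewrite scalerDl [h *: 1]mulr1 -addrA (addrC (h *: u)).
have := rP _ hr; rewrite zh.
set v := _ - _ - _ => Hv.
have -> : h^-1 *: (dotv (f (z + t *: u + h *: u)) c - dotv (f (z + t *: u)) c)
    = dotv (u *m A) c + h^-1 * dotv v c.
  rewrite /v !dotvBl -scalemxAl dotvZl [in LHS]/GRing.scale/=; field.
  exact: h0.
rewrite opprD addNKr normrN normrM normfV ler_pdivrMl ?normr_gt0//.
rewrite (le_trans (ler_norm_dotv _ _))//.
have uc : enorm u * enorm c <= (enorm u + 1) * (enorm c + 1).
  by rewrite ler_pM ?enorm_ge0// lerDl.
rewrite (le_trans (ler_wpM2r (enorm_ge0 c) Hv))// enormZ.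
rewrite -subr_ge0.
rewrite (_ : _ - _ = `|h| * e * (((enorm u + 1) * (enorm c + 1) - enorm u * enorm c) / ((enorm u + 1) * (enorm c + 1)))); last first.
  by field; rewrite !gt_eqF// ltr_wpDl// enorm_ge0.
apply: mulr_ge0; first by rewrite mulr_ge0// ltW.
by apply: divr_ge0; [rewrite subr_ge0|exact: ltW].
Unshelve. all: by end_near. Qed.

(** The mean value theorem along the segment, paired with [c = f y - f z] itself, gives
    [|c|^2 <= L |y - z| |c|], where [L] comes from a local bound on the continuous Jacobian. *)
Lemma C1_lipschitz n N (f : 'rV[R]_n -> 'rV[R]_N) A z0 :
  C1_with f A -> exists L r : R, [/\ 0 <= L, 0 < r &
    forall y z, enorm (y - z0) < r -> enorm (z - z0) < r ->
      enorm (f y - f z) <= L * enorm (y - z)].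
Proof.
move=> [_ cA fA].
have /nbhs_enormP[r r0 rP] : \forall z \near z0, `|A z| <= `|A z0| + 1.
  by have /cvgr_norm_le/(_ (`|A z0| + 1)) := cA z0; apply; rewrite ltrDl.
exists (N.+1%:R * n%:R * (`|A z0| + 1)), r; split=> // y z yr zr.
set L := _ * _ * (_ + _); set c := f y - f z.
have [c0|c0] := eqVneq c 0.
  by rewrite c0 enorm0 !mulr_ge0 ?enorm_ge0// addr_ge0.
have phi_derive (t : R) : is_derive t 1 (fun t : R => dotv (f (z + t *: (y - z))) c)
    (dotv ((y - z) *m A (z + t *: (y - z))) c).
  exact: has_jac_segment.
have phi_cont : {within `[0, 1], continuous (fun t : R => dotv (f (z + t *: (y - z))) c)}.
  apply: derivable_within_continuous => t _.
  exact: ex_derive.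
have [t] := MVT ltr01 (fun t _ => phi_derive t) phi_cont.
rewrite in_itv/= => /andP[t0 t1].
rewrite scale1r scale0r addr0 (addrC z) subrK -dotvBl -/c subr0 mulr1 -sqr_enorm => cE.
(* Balls are convex, so the intermediate point stays where the Jacobian is bounded. *)
have tr : enorm (z + t *: (y - z) - z0) < r.
  rewrite (_ : _ - _ = t *: (y - z0) + (1 - t) *: (z - z0)); last first.
    rewrite scalerBl scale1r !scalerBr; apply/rowP => j; rewrite !mxE; ring.
  rewrite (le_lt_trans (enormD _ _))// !enormZ !ger0_norm ?subr_ge0 ?ltW//.
  by nra.
have := dotv_le_enorm ((y - z) *m A (z + t *: (y - z))) c; rewrite -cE expr2.
rewrite ler_pM2r ?enorm_gt0// => /le_trans -> //.
rewrite (le_trans (ler_enorm_mulmx _ _))// /L ler_wpM2r ?enorm_ge0// ler_wpM2l//.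
exact: rP.
Qed.

End Jacobians.

(** * Multipliers of penalized problems *)

Section Stationarity.
Context {R : realType}.

Lemma enorm_sum N (I : finType) (F : I -> 'rV[R]_N) :
  enorm (\sum_i F i) <= \sum_i enorm (F i).
Proof.
elim/big_rec2: _ => [|i y x _ xy]; first by rewrite enorm0.
by rewrite (le_trans (enormD _ _))// lerD2l.
Qed.

Lemma ler_enorm_sum N (x : 'rV[R]_N) : enorm x <= \sum_j `|x 0 j|.
Proof.
rewrite {1}[x]row_sum_delta (le_trans (enorm_sum _))//.
apply: ler_sum => j _; rewrite enormZ ler_piMr//.
by rewrite /enorm dotv_delta mxE !eqxx sqrtr1.
Qed.

Lemma ler_enorm_coordwise N (x y : 'rV[R]_N) :
  (forall j, `|x 0 j| <= `|y 0 j|) -> enorm x <= enorm y.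
Proof.
move=> xy; rewrite -(@ler_pXn2r _ 2) ?nnegrE ?enorm_ge0// !sqr_enorm.
apply: ler_sum => j _; rewrite -!expr2 -real_normK ?num_real//.
by rewrite -[leRHS]real_normK ?num_real// ler_pXn2r ?nnegrE.
Qed.

Lemma sqr_enorm_row N (x : 'I_N -> R) : enorm (\row_j x j) ^+ 2 = \sum_j x j ^+ 2.
Proof. by rewrite sqr_enorm; apply: eq_bigr => j _; rewrite mxE expr2. Qed.

Lemma decreases_to0_harmonic : decreases_to0 (@harmonic R).
Proof. by split; [exact: harmonic_gt0|exact: cvg_harmonic]. Qed.

(** With [v k] the difference quotient of [f], the quotient is [t k |v k|^2 + 2 <v k, f z - p>]. *)
Lemma sqdist_quotient_cvg n N (f : 'rV[R]_n -> 'rV[R]_N) z A p u (t : nat -> R) :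
  has_jac f z A -> decreases_to0 t ->
  (t k)^-1 * (enorm (f (z + t k *: u) - p) ^+ 2 - enorm (f z - p) ^+ 2)
    @[k --> \oo] --> 2 * dotv (u *m A) (f z - p).
Proof.
move=> fA t0; pose v k := (t k)^-1 *: (f (z + t k *: u) - f z).
have vu : v @ \oo --> u *m A.
  by apply: (has_jac_cvg fA t0); exact: cvg_cst.
have quotE i : (t i)^-1 * (enorm (f (z + t i *: u) - p) ^+ 2 - enorm (f z - p) ^+ 2)
    = t i * dotv (v i) (v i) + 2 * dotv (v i) (f z - p).
  have ti : t i != 0 by rewrite gt_eqF// t0.1.
  have -> : f (z + t i *: u) - p = t i *: v i + (f z - p).
    by rewrite /v scalerA mulfV// scale1r addrA subrK.
  by rewrite (sqr_enormD (t i *: v i)) addrK enormZ exprMn real_normK ?num_real// dotvZl -sqr_enorm; field.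
rewrite (eq_cvg _ _ quotE).
have -> : 2 * dotv (u *m A) (f z - p) =
    0 * dotv (u *m A) (u *m A) + 2 * dotv (u *m A) (f z - p) by rewrite mul0r add0r.
apply: cvgD; first by apply: cvgM; [exact: t0.2|exact: cvg_dotv].
by apply: cvgM; [exact: cvg_cst|apply: cvg_dotv => //; exact: cvg_cst].
Qed.

(** The smooth part has slope [<u, xi>] along [u], and minimality up to [c |y - z|] makes it at
    least [- c |u|]; taking [u = - xi] gives [|xi|^2 <= c |xi|]. *)
Lemma penalty_stationarity n N J (M : 'I_J -> nat)
    (P : 'rV[R]_n -> 'rV[R]_N) (A : 'M[R]_(n, N))
    (Q : forall i, 'rV[R]_n -> 'rV[R]_(M i)) (B : forall i, 'M[R]_(n, M i))
    z p (q : forall i, 'rV[R]_(M i)) (a b c r : R) :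
  has_jac P z A -> (forall i, has_jac (Q i) z (B i)) -> 0 < r -> 0 <= c ->
  (forall y, enorm (y - z) < r ->
     a * enorm (P z - p) ^+ 2 + b * (\sum_i enorm (Q i z - q i) ^+ 2)
     <= a * enorm (P y - p) ^+ 2 + b * (\sum_i enorm (Q i y - q i) ^+ 2)
        + c * enorm (y - z)) ->
  enorm ((2 * a) *: (P z - p) *m A^T
         + \sum_i (2 * b) *: (Q i z - q i) *m (B i)^T) <= c.
Proof.
move=> PA QB r0 c0 zmin; set xi := _ + _.
pose phi y := a * enorm (P y - p) ^+ 2 + b * (\sum_i enorm (Q i y - q i) ^+ 2).
pose t := @harmonic R; have t0 : decreases_to0 t := decreases_to0_harmonic.
have slope u : (t k)^-1 * (phi (z + t k *: u) - phi z) @[k --> \oo] --> dotv u xi.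
  have quotE i : (t i)^-1 * (phi (z + t i *: u) - phi z) =
      a * ((t i)^-1 * (enorm (P (z + t i *: u) - p) ^+ 2 - enorm (P z - p) ^+ 2))
      + b * \sum_l ((t i)^-1 * (enorm (Q l (z + t i *: u) - q l) ^+ 2
                                - enorm (Q l z - q l) ^+ 2)).
    by rewrite -mulr_sumr sumrB /phi; ring.
  rewrite (eq_cvg _ _ quotE).
  have -> : dotv u xi = a * (2 * dotv (u *m A) (P z - p))
      + b * \sum_l (2 * dotv (u *m B l) (Q l z - q l)).
    rewrite /xi [LHS]dotvDr dotv_mulmx_tr dotvZr dotv_sumr -mulr_sumr !mulrA.
    rewrite (mulrC a) (mulrC b) mulr_sumr; congr (_ + _); apply: eq_bigr => l _.
    by rewrite dotv_mulmx_tr dotvZr.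
  apply: cvgD; apply: cvgM; try exact: cvg_cst; first exact: sqdist_quotient_cvg.
  apply: cvg_big => [|l _]; first exact: add_continuous.
  exact: sqdist_quotient_cvg.
have slope_ge u : - (c * enorm u) <= dotv u xi.
  have tu : t k *: u @[k --> \oo] --> (0 : 'rV[R]_n).
    by rewrite -(scale0r u); apply: cvgZ; [exact: t0.2|exact: cvg_cst].
  apply: (cvgr_to_ge (slope u)); near=> k.
  rewrite ler_pdivlMl ?t0.1// mulrN.
  have : enorm (t k *: u - 0) < r by near: k; move/cvg_enormP : tu; exact.
  have zu : z + t k *: u - z = t k *: u by rewrite addrAC subrr add0r.
  rewrite subr0 -zu => tr.
  have := zmin _ tr; rewrite -/(phi _) -/(phi _) zu enormZ gtr0_norm ?t0.1//.
  lra.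
have [->|xi0] := eqVneq xi 0; first by rewrite enorm0.
have := slope_ge (- xi).
by rewrite dotvNl enormN -sqr_enorm lerN2 expr2 ler_pM2r// enorm_gt0.
Unshelve. all: by end_near. Qed.

End Stationarity.

(** * Approximate multipliers at points where the error bound fails *)

Section ApproximateMultipliers.
Context {R : realType} {n N J : nat} {M : 'I_J -> nat}.
Variables (P : 'rV[R]_n -> 'rV[R]_N) (A : 'rV[R]_n -> 'M[R]_(n, N)).
Variables (Q : forall i, 'rV[R]_n -> 'rV[R]_(M i)).
Variables (B : forall i, 'rV[R]_n -> 'M[R]_(n, M i)).
Variables (D : set 'rV[R]_N) (E : forall i, set 'rV[R]_(M i)).
Variables (z0 : 'rV[R]_n) (kap L r : R).
Hypotheses (P_C1 : C1_with P A) (Q_C1 : forall i, C1_with (Q i) (B i)).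
Hypotheses (D_closed : closed D) (E_closed : forall i, closed (@E i)).
Hypotheses (D_z0 : D (P z0)) (E_z0 : forall i, @E i (Q i z0)).
Hypotheses (kap_gt0 : 0 < kap) (L_ge0 : 0 <= L).
Hypothesis subregular : forall z, enorm (z - z0) < r ->
  edistance z (P @^-1` D) <= kap * edistance (P z) D.
Hypothesis Q_lipschitz : forall i y z, enorm (y - z0) < r -> enorm (z - z0) < r ->
  enorm (Q i y - Q i z) <= L * enorm (y - z).

Definition system_solutions : set 'rV[R]_n :=
  [set z | D (P z) /\ forall i, @E i (Q i z)].

Definition system_residual z : R :=
  edistance (P z) D + \sum_i edistance (Q i z) (@E i).

Local Notation F := system_solutions.
Local Notation S := (P @^-1` D).

Let S_closed : closed S.
Proof. by have [cP _ _] := P_C1; exact: (iffLR (continuous_closedP _) cP). Qed.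

Let S0 : S !=set0. Proof. by exists z0. Qed.
Let F0 : F !=set0. Proof. by exists z0; split. Qed.
Let D0 : D !=set0. Proof. by exists (P z0). Qed.
Let E0 i : @E i !=set0. Proof. by exists (Q i z0). Qed.

Let sum_ge0 z : 0 <= \sum_i edistance (Q i z) (@E i).
Proof. by apply: sumr_ge0 => i _; exact: edistance_ge0. Qed.

Let dist_lipschitz i y z : enorm (y - z0) < r -> enorm (z - z0) < r ->
  edistance (Q i y) (@E i) <= edistance (Q i z) (@E i) + L * enorm (y - z).
Proof.
move=> yr zr; rewrite (le_trans (edistance_lipschitz _ (Q i z) (E0 i)))//.
by rewrite lerD2l Q_lipschitz.
Qed.

(** Replacing the bad point [z] by its projection [s] costs at most [kap d1] in the distance to [F]
    and [J L kap d1] in the distances to the [E i]; [K] is what makes the violated bound absorb both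
    losses. *)
Lemma solution_far_from_feasible eps :
  (forall kappa delta : R, 0 < kappa -> 0 < delta -> exists z,
     enorm (z - z0) < delta /\ kappa * system_residual z < edistance z F) ->
  0 < eps -> eps <= r ->
  exists s, [/\ S s, enorm (s - z0) < eps &
    \sum_i edistance (Q i s) (@E i) < eps * edistance s F].
Proof.
move=> no_bound e0 er; pose K := (1 + kap * (J%:R * L + eps)) / eps.
have JL0 : 0 <= J%:R * L by rewrite mulr_ge0.
have K0 : 0 < K by rewrite divr_gt0// ltr_wpDr// mulr_ge0 ?addr_ge0// ltW.
have e2 : 0 < eps / 2 by lra.
have [z [zd]] := no_bound K (eps / 2) K0 e2.
rewrite /system_residual; set d1 := edistance (P z) D.
set rho := \sum_i _ => Kd.
have [s Ss zs] := edistance_attained z S_closed S0.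
have szz0 : enorm (z - s) <= enorm (z - z0) by rewrite -zs edistance_le.
have szk : enorm (z - s) <= kap * d1 by rewrite -zs subregular//; lra.
(* As [z0] lies in [S], projecting at most doubles the distance to [z0]; hence the radius [eps / 2]
   above. *)
have sz0 : enorm (s - z0) < eps.
  by rewrite (le_lt_trans (enorm_triangle _ z _))// (enormB s); lra.
exists s; split => //.
have d10 : 0 <= d1 by exact: edistance_ge0.
have rho0 : 0 <= rho by exact: sum_ge0.
have rho_s : \sum_i edistance (Q i s) (@E i) <= rho + J%:R * L * enorm (z - s).
  rewrite (_ : J%:R * L * _ = \sum_(i < J) L * enorm (s - z)).
    rewrite -big_split/=; apply: ler_sum => i _; apply: dist_lipschitz; lra.
  by rewrite sumr_const card_ord -[RHS]mulr_natl mulrA enormB.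
have dsF : edistance z F <= edistance s F + enorm (z - s).
  exact: edistance_lipschitz.
have Ke : eps * K = 1 + kap * (J%:R * L + eps) by rewrite /K; field; lra.
have : (1 + kap * (J%:R * L + eps)) * (d1 + rho) < eps * (edistance s F + enorm (z - s)).
  by rewrite -Ke -mulrA ltr_pM2l// (lt_le_trans Kd).
have ? : J%:R * L * enorm (z - s) <= J%:R * L * (kap * d1) by rewrite ler_wpM2l.
have ? : eps * enorm (z - s) <= eps * (kap * d1) by rewrite ler_wpM2l// ltW.
have ? : 0 <= kap * (J%:R * L + eps) * rho by rewrite !mulr_ge0 ?addr_ge0// ltW.
lra.
Qed.

Let distD_continuous : continuous (fun z => edistance (P z) D).
Proof.
move=> z; have [cP _ _] := P_C1.
exact: (cvg_comp _ _ (cP z) (@edistance_continuous _ _ _ D0 (P z))).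
Qed.

Let distE_continuous i : continuous (fun z => edistance (Q i z) (@E i)).
Proof.
move=> z; have [cQ _ _] := Q_C1 i.
exact: (cvg_comp _ _ (cQ z) (@edistance_continuous _ _ _ (E0 i) (Q i z))).
Qed.

(** Aggregated by its Euclidean norm, not by the sum of [system_residual]: the square root of a sum
    of squares has a smooth majorant touching it wherever one block is nonzero, even if other blocks
    vanish. *)
Let distEs z : 'rV[R]_J := \row_i edistance (Q i z) (@E i).

Let enorm_distEs_continuous : continuous (fun z => enorm (distEs z)).
Proof.
move=> z; apply: (@cvg_enorm _ _ (nbhs z) _ _ distEs).
apply: (@cvg_mx _ _ (nbhs z)) => i j.
rewrite mxE; under eq_cvg do rewrite mxE.
exact: distE_continuous.
Qed.

Let residual_continuous : continuous system_residual.
Proof.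
move=> z; rewrite /system_residual.
apply: (@cvgD _ _ _ (nbhs z) _); first exact: distD_continuous.
apply: (@cvg_big _ _ _ _ _ _ _ (nbhs z)) => [|i _]; first exact: add_continuous.
exact: distE_continuous.
Qed.

Let enorm_distEs_le z : enorm (distEs z) <= \sum_i edistance (Q i z) (@E i).
Proof.
rewrite (le_trans (ler_enorm_sum _))//; apply: ler_sum => i _.
by rewrite mxE ger0_norm// edistance_ge0.
Qed.

Let residual_gt0 z : 0 < edistance z F -> 0 < system_residual z.
Proof.
move=> zF; rewrite lt_def addr_ge0 ?edistance_ge0// andbT.
apply: contraL zF; rewrite paddr_eq0 ?edistance_ge0// => /andP[/eqP Pz Qz].
rewrite -leNgt edistance_mem//; split; first exact: edistance0_mem Pz.
move=> i; apply: edistance0_mem => //.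
move: Qz; rewrite psumr_eq0 => [/allP/(_ i (mem_index_enum _))/eqP//|? _].
exact: edistance_ge0.
Qed.

(** The factor [2] of the tilt puts the minimizer at distance less than [d / 2] from [s], thus in
    the interior of the ball of radius [d], where stationarity can be exploited. *)
Lemma penalty_minimizer eps s :
  0 < eps -> S s -> \sum_i edistance (Q i s) (@E i) < eps * edistance s F ->
  exists (j : R) z, [/\ 0 < j,
    [/\ enorm (z - s) < edistance s F / 2, 0 < enorm (distEs z),
        edistance (P z) D < eps * edistance s F / 2 &
        enorm (distEs z) < eps * edistance s F] &
    forall y, enorm (y - s) <= edistance s F ->
      enorm (distEs z) + j * edistance (P z) D ^+ 2 + 2 * eps * enorm (z - s) <=
      enorm (distEs y) + j * edistance (P y) D ^+ 2 + 2 * eps * enorm (y - s)].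
Proof.
move=> e0 Ss; set d := edistance s F => sE.
have ed0 : 0 < eps * d by exact: le_lt_trans (sum_ge0 s) sE.
have d0 : 0 < d by rewrite pmulr_rgt0 in ed0.
have [c cs cmin] : exists2 c, cball s (d / 2) c &
    forall y, cball s (d / 2) y -> system_residual c <= system_residual y.
  apply: continuous_min_compact => //; last exact: cball_compact.
  by exists s; rewrite /cball/= subrr enorm0; lra.
have c0 : 0 < system_residual c.
  apply: residual_gt0; have := edistance_lipschitz s c F0.
  by move: cs; rewrite /cball/= enormB -/d; lra.
(* [eta] is at most the least residual on the half ball, and [j] is calibrated so that
   [j d(P z, D)^2 < eps d] means [d(P z, D) < eta]. *)
pose eta := Num.min (system_residual c) (eps * d / 2).
have eta0 : 0 < eta by rewrite lt_min c0/= divr_gt0.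
pose j := eps * d / eta ^+ 2.
have j0 : 0 < j by rewrite divr_gt0// exprn_gt0.
pose Phi y := enorm (distEs y) + j * edistance (P y) D ^+ 2 + 2 * eps * enorm (y - s).
have Phi_cont : continuous Phi.
  move=> y; apply: (@cvgD _ _ _ (nbhs y) _).
    apply: (@cvgD _ _ _ (nbhs y) _); first exact: enorm_distEs_continuous.
    apply: (@cvgM _ _ (nbhs y) _); first exact: cvg_cst.
    by rewrite expr2; apply: (@cvgM _ _ (nbhs y) _); exact: distD_continuous.
  apply: (@cvgM _ _ (nbhs y) _); first exact: cvg_cst.
  exact: enormB_continuous.
have [z zs zmin] : exists2 z, cball s d z & forall y, cball s d y -> Phi z <= Phi y.
  apply: continuous_min_compact => //; last exact: cball_compact.
  by exists s; rewrite /cball/= subrr enorm0 ltW.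
(* Comparison with [s], where both the penalty and the tilt vanish; all bounds on [z] follow from
   it. *)
have Phi_z : Phi z < eps * d.
  have sb : cball s d s by rewrite /cball/= subrr enorm0 ltW.
  rewrite (le_lt_trans (zmin _ sb))// /Phi (@edistance_mem _ _ (P s) D Ss) subrr enorm0.
  by rewrite expr0n/= !mulr0 !addr0 (le_lt_trans (enorm_distEs_le s)).
have distEs0 := enorm_ge0 (distEs z).
have zs0 := enorm_ge0 (z - s).
have Pz0 : 0 <= j * edistance (P z) D ^+ 2 by rewrite mulr_ge0 ?sqr_ge0// ltW.
have zs0' : 0 <= 2 * eps * enorm (z - s) by rewrite !mulr_ge0// ltW.
have zs2 : enorm (z - s) < d / 2.
  by rewrite -(ltr_pM2l e0); move: Phi_z; rewrite /Phi; lra.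
have Pz : edistance (P z) D < eta.
  rewrite -(@ltr_pXn2r _ 2) ?nnegrE ?edistance_ge0 ?(ltW eta0)// -(ltr_pM2l j0).
  rewrite [ltRHS](_ : _ = eps * d); last by rewrite /j divfK// expf_neq0// gt_eqF.
  by move: Phi_z; rewrite /Phi; lra.
move: Pz; rewrite lt_min => /andP[Pzc Pzd].
have Qz : 0 < \sum_i edistance (Q i z) (@E i).
  by have := cmin z (ltW zs2); move: Pzc; rewrite [system_residual z]/system_residual; lra.
exists j, z; split => //; split => //.
  rewrite lt_def distEs0 andbT; apply: contraL Qz => /eqP/enorm_eq0/rowP Qz.
  rewrite -leNgt big1// => i _.
  by have := Qz i; rewrite !mxE.
by move: Phi_z; rewrite /Phi; lra.
Qed.

(** Freezing the projections [p] and [q i] of the minimizer replaces each distance by a function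
    that majorizes it and agrees with it at [z]. Stationarity of the majorant gives multiples of
    [P z - p] and [Q i z - q i], which are proximal normals. *)
Lemma approximate_multipliers eps :
  (forall kappa delta : R, 0 < kappa -> 0 < delta -> exists z,
     enorm (z - z0) < delta /\ kappa * system_residual z < edistance z F) ->
  0 < eps -> eps <= 1 -> 2 * eps <= r ->
  exists z p mu (q lam : forall i, 'rV[R]_(M i)),
   [/\ [/\ z != z0, enorm (z - z0) < 2 * eps,
           enorm mu <= 2 * ((J%:R * L + 2) * kap) &
           \sum_i enorm (lam i) ^+ 2 = 1],
       enorm (P z - p) <= 2 * eps * enorm (z - z0) /\
         (forall i, enorm (Q i z - q i) <= 2 * eps * enorm (z - z0)),
       regular_normal_cone D p mu /\
         (forall i, regular_normal_cone (@E i) (q i) (lam i)) &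
       enorm (mu *m (A z)^T + \sum_i lam i *m (B i z)^T) <= 2 * eps].
Proof.
move=> no_bound e0 e1 er; have er' : eps <= r by lra.
have [s [Ss sz0 sE]] := solution_far_from_feasible no_bound e0 er'.
have [j [z [j0 [zs sig0 Pzd sigd] zmin]]] := penalty_minimizer e0 Ss sE.
set d := edistance s F in sE zs Pzd sigd zmin; set sig := enorm (distEs z) in sig0 sigd zmin.
have d0 : 0 < d by have := enorm_ge0 (z - s); lra.
have dz0 : d <= enorm (s - z0) by apply: edistance_le; split.
have zz0 : enorm (z - z0) < 2 * eps.
  by rewrite (le_lt_trans (enorm_triangle _ s _))//; lra.
have dz : d <= 2 * enorm (z - z0).
  have : d <= edistance z F + enorm (s - z) by exact: edistance_lipschitz.
  have : edistance z F <= enorm (z - z0) by apply: edistance_le; split.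
  by rewrite (enormB s); lra.
have edz : eps * d <= 2 * eps * enorm (z - z0).
  by rewrite (mulrC 2) -mulrA ler_wpM2l// ltW.
have [p Dp Pp] := edistance_attained (P z) D_closed D0.
have qex i : {qi | @E i qi /\ edistance (Q i z) (@E i) = enorm (Q i z - qi)}.
  by apply: cid; have [qi ? ?] := edistance_attained (Q i z) (E_closed (i := i)) (E0 i); exists qi.
pose q i := sval (qex i).
have Eq i : @E i (q i) by have [] := svalP (qex i).
have Qq i : edistance (Q i z) (@E i) = enorm (Q i z - q i) by have [] := svalP (qex i).
have sig2 : sig ^+ 2 = \sum_i enorm (Q i z - q i) ^+ 2.
  by rewrite sqr_enorm_row; apply: eq_bigr => i _; rewrite Qq.
(* Derivative of the square root at [sig ^+ 2]; it gives the family [lam] total length 1. *)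
pose b := (2 * sig)^-1.
have b0 : 0 < b by rewrite invr_gt0; lra.
have bsig : 2 * b * sig = 1 by rewrite /b; field; lra.
exists z, p, ((2 * j) *: (P z - p)), q, (fun i => (2 * b) *: (Q i z - q i)).
split; first split => //.
- by apply: contraTneq dz => ->; rewrite subrr enorm0; lra.
- (* Comparing [z] with its projection [s'] on [S] bounds the multiplier of the
     squared penalty, by metric subregularity. *)
  have [s' Ss' zs'] := edistance_attained z S_closed S0.
  have zr : enorm (z - z0) < r by lra.
  have zs'k : enorm (z - s') <= kap * enorm (P z - p).
    by rewrite -zs' -Pp subregular.
  (* [s] is itself in [S], so [s'] is no farther from [z] than [s] and stays in the ball on which
     [z] is minimal. *)
  have zs's : enorm (z - s') <= enorm (z - s) by rewrite -zs' edistance_le.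
  have s's : enorm (s' - s) <= d.
    by rewrite (le_trans (enorm_triangle _ z _))// (enormB s'); lra.
  have s'r : enorm (s' - z0) < r.
    by rewrite (le_lt_trans (enorm_triangle _ s _))//; lra.
  have sig_s' : enorm (distEs s') <= sig + J%:R * (L * enorm (z - s')).
    rewrite addrC -lerBlDr (le_trans (ler_enormB _ _))//.
    rewrite (le_trans (ler_enorm_sum _))//.
    apply: (@le_trans _ _ (\sum_(i < J) L * enorm (z - s'))); last first.
      by rewrite sumr_const card_ord -[leLHS]mulr_natl.
    apply: ler_sum => i _; rewrite !mxE (le_trans (edistance_dist _ _ (E0 i)))//.
    by rewrite (enormB z) Q_lipschitz.
  have := zmin s' s's; rewrite (@edistance_mem _ _ (P s') D Ss') Pp expr0n/= mulr0 addr0.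
  rewrite -/sig enormZ ger0_norm; last by rewrite mulr_ge0// ltW.
  have := enorm_triangle s' z s; rewrite (enormB s' z).
  set x := enorm (P z - p) in zs'k *.
  have x0 : 0 <= x by exact: enorm_ge0.
  move=> tri Hmin.
  have : j * x ^+ 2 <= (J%:R * L + 2 * eps) * enorm (z - s').
    have := ler_wpM2l (ltW e0) tri; lra.
  have : (J%:R * L + 2 * eps) * enorm (z - s') <= (J%:R * L + 2) * (kap * x).
    apply: ler_pM => //; rewrite ?enorm_ge0//; last by lra.
    by rewrite addr_ge0 ?mulr_ge0// ltW.
  move=> /[swap] /le_trans /[apply]; rewrite expr2 mulrA (mulrA _ kap) => jx.
  have [->|xn0] := eqVneq x 0.
    by rewrite mulr0 !mulr_ge0 ?addr_ge0 ?mulr_ge0// ltW.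
  by rewrite -mulrA ler_pM2l// -(ler_pM2r (_ : 0 < x))// lt_def xn0.
- under eq_bigr do rewrite enormZ exprMn.
  rewrite -mulr_sumr -sig2 -exprMn ger0_norm; last by rewrite mulr_ge0// ltW.
  by rewrite bsig expr1n.
- split; first by rewrite -Pp; lra.
  move=> i; rewrite -Qq (le_trans _ edz)// (le_trans _ (ltW sigd))//.
  have := ler_enorm_coord (distEs z) i; rewrite mxE ger0_norm//.
  exact: edistance_ge0.
- split=> [|i]; apply: regular_normal_projection => //; rewrite mulr_ge0// ltW//.
have [_ _ PA] := P_C1.
have QB i : has_jac (Q i) z (B i z) by have [_ _ ] := Q_C1 i.
(* Points within [d / 2] of [z] are within [d] of [s], where the minimality of [z] is available. *)
apply: (penalty_stationarity (PA z) QB (r := d / 2)); [lra|lra|] => y yz.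
have ys : enorm (y - s) <= enorm (y - z) + enorm (z - s) by exact: enorm_triangle.
(* Concavity of the square root: [X - sig <= (X^2 - sig^2) / (2 sig)], which
   replaces the norm by a smooth majorant touching it at [z]. *)
pose X := enorm (\row_i enorm (Q i y - q i)).
have yX : enorm (distEs y) <= X.
  apply: ler_enorm_coordwise => i; rewrite !mxE !ger0_norm ?edistance_ge0 ?enorm_ge0//.
  exact: edistance_le.
have yP : edistance (P y) D ^+ 2 <= enorm (P y - p) ^+ 2.
  by rewrite ler_pXn2r ?nnegrE ?edistance_ge0 ?enorm_ge0// edistance_le.
rewrite -sig2 -(sqr_enorm_row (fun i => enorm (Q i y - q i))) -/X.
have ysd : enorm (y - s) <= d by lra.
have := zmin y ysd; rewrite Pp => Hmin.
have XE : X - sig <= b * X ^+ 2 - b * sig ^+ 2.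
  have -> : b * sig ^+ 2 = sig / 2 by rewrite /b; field; lra.
  have : 0 <= b * (X - sig) ^+ 2 by rewrite mulr_ge0 ?sqr_ge0// ltW.
  have -> : b * (X - sig) ^+ 2 = b * X ^+ 2 - (2 * b * sig) * X + (2 * b * sig) * sig / 2 by field.
  by rewrite bsig; lra.
have := ler_wpM2l (ltW e0) ys; have := ler_wpM2l (ltW j0) yP; lra.
Qed.

End ApproximateMultipliers.

(** * Directional error bound *)

Section DirectionalErrorBound.
Context {R : realType}.

(** Closed balls are compact, and an ultrafilter converges to each of its cluster points. *)
Lemma ultra_cvg_bounded N (U : set_system nat) (x : nat -> 'rV[R]_N) C :
  UltraFilter U -> (forall k, enorm (x k) <= C) -> exists l : 'rV[R]_N, x @ U --> l.
Proof.
move=> UU xC; have UP : ProperFilter U := @ultra_proper _ U UU.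
have xU : (x @ U) (cball 0 C).
  by apply: (@filterE _ U) => k; rewrite /cball/= subr0 xC.
have [l [_ lx]] := @cball_compact R N 0 C (x @ U) _ xU.
exists l => V Vl; have [//|nV] := in_ultra_setVsetC (x @^-1` V) UU.
by have [y [nVy Vy]] := lx (~` V) V nV Vl.
Qed.

Lemma cvg_enorm_le N (x : nat -> 'rV[R]_N) l (c : nat -> R) :
  c @ \oo --> (0 : R) -> (forall k, enorm (x k - l) <= c k) -> x @ \oo --> l.
Proof.
move=> c0 xc; apply/cvg_enormP => e e0; near=> k.
rewrite (le_lt_trans (xc k))//; near: k.
exact: (cvgr_lt _ c0 _ e0).
Unshelve. all: by end_near. Qed.

Lemma C1_lipschitz_family n J (M : 'I_J -> nat)
    (Q : forall i, 'rV[R]_n -> 'rV[R]_(M i))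
    (B : forall i, 'rV[R]_n -> 'M[R]_(n, M i)) z0 :
  (forall i, C1_with (Q i) (B i)) -> exists L r : R, [/\ 0 <= L, 0 < r &
    forall i y z, enorm (y - z0) < r -> enorm (z - z0) < r ->
      enorm (Q i y - Q i z) <= L * enorm (y - z)].
Proof.
move=> Q_C1; have /choice[Lr LrP] : forall i, exists Lr : R * R,
    [/\ 0 <= Lr.1, 0 < Lr.2 &
    forall y z, enorm (y - z0) < Lr.2 -> enorm (z - z0) < Lr.2 ->
      enorm (Q i y - Q i z) <= Lr.1 * enorm (y - z)].
  by move=> i; have [L [r LrP]] := C1_lipschitz z0 (Q_C1 i); exists (L, r).
(* The sum dominates every constant, and the default [1] keeps the radius positive when [J = 0]. *)
exists (\sum_i (Lr i).1), (\big[Num.min/1]_i (Lr i).2); split.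
- by apply: sumr_ge0 => i _; have [] := LrP i.
- by apply/bigmin_gtP; split => // i _; have [] := LrP i.
move=> i y z yr zr; have [L0 r0 H] := LrP i.
have rle : \big[Num.min/1]_i (Lr i).2 <= (Lr i).2 by exact: bigmin_le_cond.
rewrite (le_trans (H _ _ (lt_le_trans yr rle) (lt_le_trans zr rle)))//.
rewrite ler_wpM2r ?enorm_ge0// (bigD1 i)//= lerDl sumr_ge0// => k _.
by have [] := LrP k.
Qed.

(** Stated for arbitrary closed sets. The linearized cone is implicit here: a directional normal
    cone is empty unless its direction is tangent. *)
Lemma directional_error_bound n N J (M : 'I_J -> nat)
    (P : 'rV[R]_n -> 'rV[R]_N) (A : 'rV[R]_n -> 'M[R]_(n, N))
    (Q : forall i, 'rV[R]_n -> 'rV[R]_(M i))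
    (B : forall i, 'rV[R]_n -> 'M[R]_(n, M i))
    (D : set 'rV[R]_N) (E : forall i, set 'rV[R]_(M i)) (z0 : 'rV[R]_n) :
  C1_with P A -> (forall i, C1_with (Q i) (B i)) ->
  closed D -> (forall i, closed (E i)) -> D (P z0) -> (forall i, E i (Q i z0)) ->
  metrically_subregular P D z0 ->
  (forall w mu (lam : forall i, 'rV[R]_(M i)), w != 0 ->
     dir_normal_cone D (P z0) (w *m A z0) mu ->
     (forall i, dir_normal_cone (E i) (Q i z0) (w *m B i z0) (lam i)) ->
     mu *m (A z0)^T + \sum_i lam i *m (B i z0)^T = 0 -> forall i, lam i = 0) ->
  exists kappa delta : R, [/\ 0 < kappa, 0 < delta &
    forall z, eball z0 delta z ->
      edistance z (system_solutions P Q D E) <= kappa * system_residual P Q D E z].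
Proof.
move=> P_C1 Q_C1 Dc Ec Dz0 Ez0 [kap kap0 /nbhs_enormP[r1 r10 subreg]] nodir.
apply: contrapT => noEB.
have no_bound (kappa delta : R) : 0 < kappa -> 0 < delta -> exists z,
    enorm (z - z0) < delta /\
    kappa * system_residual P Q D E z < edistance z (system_solutions P Q D E).
  move=> kappa0 delta0; apply: contrapT => H; apply: noEB.
  exists kappa, delta; split => // z zd; rewrite leNgt; apply/negP => zk.
  by apply: H; exists z.
have [L [r2 [L0 r20 lipQ]]] := C1_lipschitz_family z0 Q_C1.
pose r := Num.min r1 r2.
have r0 : 0 < r by rewrite lt_min r10.
have rr1 : r <= r1 by rewrite ge_min lexx.
have rr2 : r <= r2 by rewrite ge_min lexx orbT.
pose C := 2 * ((J%:R * L + 2) * kap).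
(* Ensures [eps k <= 1] and [2 * eps k <= r] for every [k]. *)
pose e0 := Num.min 1 (r / 2).
have e00 : 0 < e0 by rewrite lt_min ltr01 divr_gt0.
pose eps k := e0 * harmonic k.
have eps0 k : 0 < eps k by rewrite mulr_gt0// harmonic_gt0.
have epse0 k : eps k <= e0.
  have h1 : harmonic k <= 1 :> R by rewrite /harmonic/= invf_le1 ?ltr0n// ler1n.
  by rewrite -[leRHS]mulr1 ler_wpM2l// ltW.
have eps_cvg : (2 * eps k) @[k --> \oo] --> (0 : R).
  rewrite -(mulr0 2) -[X in 2 * X](mulr0 e0).
  by apply: cvgM; [exact: cvg_cst|apply: cvgM; [exact: cvg_cst|exact: cvg_harmonic]].
have approx k : {x : ('rV[R]_n * 'rV[R]_N * 'rV[R]_N) *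
    ((forall i, 'rV[R]_(M i)) * (forall i, 'rV[R]_(M i))) |
   [/\ [/\ x.1.1.1 != z0, enorm (x.1.1.1 - z0) < 2 * eps k,
           enorm x.1.2 <= C & \sum_i enorm (x.2.2 i) ^+ 2 = 1],
       enorm (P x.1.1.1 - x.1.1.2) <= 2 * eps k * enorm (x.1.1.1 - z0) /\
         (forall i, enorm (Q i x.1.1.1 - x.2.1 i) <= 2 * eps k * enorm (x.1.1.1 - z0)),
       regular_normal_cone D x.1.1.2 x.1.2 /\
         (forall i, regular_normal_cone (E i) (x.2.1 i) (x.2.2 i)) &
       enorm (x.1.2 *m (A x.1.1.1)^T + \sum_i x.2.2 i *m (B i x.1.1.1)^T) <= 2 * eps k]}.
  apply: cid.
  have eps1 : eps k <= 1 by rewrite (le_trans (epse0 k))// ge_min lexx.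
  have epsr : 2 * eps k <= r.
    have : e0 <= r / 2 by rewrite ge_min lexx orbT.
    by have := epse0 k; lra.
  have subreg' z : enorm (z - z0) < r ->
      edistance z (P @^-1` D) <= kap * edistance (P z) D.
    by move=> zr; exact: subreg (lt_le_trans zr rr1).
  have lipQ' i y z : enorm (y - z0) < r -> enorm (z - z0) < r ->
      enorm (Q i y - Q i z) <= L * enorm (y - z).
    by move=> yr zr; apply: lipQ; [exact: lt_le_trans yr rr2|exact: lt_le_trans zr rr2].
  have [z [p [mu [q [lam H]]]]] := approximate_multipliers P_C1 Q_C1 Dc Ec
    Dz0 Ez0 kap0 L0 subreg' lipQ' no_bound (eps0 k) eps1 epsr.
  by exists ((z, p, mu), (q, lam)).
pose z k := (sval (approx k)).1.1.1; pose p k := (sval (approx k)).1.1.2.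
pose mu k := (sval (approx k)).1.2.
pose q i k := (sval (approx k)).2.1 i; pose lam i k := (sval (approx k)).2.2 i.
have zz0 k : z k != z0 by have [[]] := svalP (approx k).
have z_eps k : enorm (z k - z0) < 2 * eps k by have [[]] := svalP (approx k).
have mu_bnd k : enorm (mu k) <= C by have [[]] := svalP (approx k).
have lam1 k : \sum_i enorm (lam i k) ^+ 2 = 1 by have [[]] := svalP (approx k).
have Pp k : enorm (P (z k) - p k) <= 2 * eps k * enorm (z k - z0).
  by have [_ []] := svalP (approx k).
have Qq i k : enorm (Q i (z k) - q i k) <= 2 * eps k * enorm (z k - z0).
  by have [_ [_ +] _ _] := svalP (approx k); apply.
have p_mu k : regular_normal_cone D (p k) (mu k).
  by have [_ _ []] := svalP (approx k).
have q_lam i k : regular_normal_cone (E i) (q i k) (lam i k).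
  by have [_ _ [_ +] _] := svalP (approx k); apply.
have stat k : enorm (mu k *m (A (z k))^T + \sum_i lam i k *m (B i (z k))^T) <= 2 * eps k.
  by have [_ _ _] := svalP (approx k).
clearbody z p mu q lam.
pose t k := enorm (z k - z0).
have t0 k : 0 < t k by rewrite enorm_gt0// subr_eq0.
pose d k := (t k)^-1 *: (z k - z0).
have d1 k : enorm (d k) = 1.
  by rewrite enormZ gtr0_norm ?invr_gt0// mulVf// gt_eqF.
have lam_bnd i k : enorm (lam i k) <= 1.
  rewrite -(@ler_pXn2r _ 2) ?nnegrE ?enorm_ge0// expr1n -(lam1 k).
  by rewrite (bigD1 i)//= lerDl sumr_ge0// => l _; exact: sqr_ge0.
(* An ultrafilter finer than [\oo] yields one limit point for all the bounded
   sequences at once, including the [J] blocks of [lam]. *)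
have [U [UU ooU]] := ultraFilterLemma (F := \oo : set_system nat) _.
have UP : ProperFilter U := @ultra_proper _ U UU.
have d_bnd k : enorm (d k) <= 1 by rewrite d1.
have [w dw] := ultra_cvg_bounded UU d_bnd.
have [m mum] := ultra_cvg_bounded UU mu_bnd.
have lim_lam i : {l : 'rV[R]_(M i) | lam i @ U --> l} by apply: cid; exact: (ultra_cvg_bounded UU (lam_bnd i)).
pose l i := sval (lim_lam i).
have laml i : lam i @ U --> l i by exact: svalP (lim_lam i).
(* Back from the ultrafilter to a sequence, as [dir_normal_cone] requires. [f] need not be monotone:
   [a <= f a] suffices for [eps (f a)] to tend to 0. *)
have /choice[f fP] (a : nat) : exists k, [/\ (a <= k)%N, enorm (d k - w) < harmonic a,
    enorm (mu k - m) < harmonic a & forall i, enorm (lam i k - l i) < harmonic a].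
  have h0 : 0 < @harmonic R a := harmonic_gt0 a.
  have U1 : U [set k | (a <= k)%N] by apply: ooU; exact: (nbhs_infty_ge a).
  have U2 : U [set k | enorm (d k - w) < harmonic a].
    by move/cvg_enormP : dw; apply; exact: h0.
  have U3 : U [set k | enorm (mu k - m) < harmonic a].
    by move/cvg_enormP : mum; apply; exact: h0.
  have U4 : U [set k | forall i, enorm (lam i k - l i) < harmonic a].
    by apply: filter_forall => i; move/cvg_enormP : (laml i); apply; exact: h0.
  have /filter_ex[k [[? ?] [? ?]]] : U ([set k | (a <= k)%N] `&`
      [set k | enorm (d k - w) < harmonic a] `&`
      ([set k | enorm (mu k - m) < harmonic a] `&`
       [set k | forall i, enorm (lam i k - l i) < harmonic a])).
    by apply: filterI; exact: filterI.
  by exists k.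
have subseq_cvg K (x : nat -> 'rV[R]_K) y :
    (forall a, enorm (x (f a) - y) < harmonic a) -> x (f a) @[a --> \oo] --> y.
  by move=> H; apply: (cvg_enorm_le cvg_harmonic) => a; exact: ltW.
have df : d (f a) @[a --> \oo] --> w by apply: subseq_cvg => a; have [] := fP a.
have muf : mu (f a) @[a --> \oo] --> m by apply: subseq_cvg => a; have [] := fP a.
have lamf i : lam i (f a) @[a --> \oo] --> l i.
  by apply: subseq_cvg => a; have [_ _ _] := fP a.
have epsf : (2 * eps (f a)) @[a --> \oo] --> (0 : R).
  apply: (@squeeze_cvgr _ _ _ _ (cst 0) (fun a => 2 * eps a)) => //; last exact: cvg_cst.
  near=> a; rewrite mulr_ge0 ?(ltW (eps0 _))//= ler_pM2l// ler_pM2l//.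
  by rewrite lef_pV2 ?posrE// ler_nat ltnS; have [] := fP a.
have tf : decreases_to0 (fun a => t (f a)).
  split=> //; apply: (@squeeze_cvgr _ _ _ _ (cst 0) (fun a => 2 * eps (f a))) => //; last exact: cvg_cst.
  by near=> a; rewrite /= (ltW (t0 _)) (ltW (z_eps _)).
have tdE k : z0 + t k *: d k = z k.
  by rewrite scalerA mulfV ?gt_eqF// scale1r addrC subrK.
(* The normals sit at the projections [x k], not at [X (z k)]; since the gap is [o(t k)], both leave
   [X z0] in the same limiting direction. *)
have quotient_cvg K (X : 'rV[R]_n -> 'rV[R]_K) Y (x : nat -> 'rV[R]_K) :
    has_jac X z0 Y -> (forall k, enorm (X (z k) - x k) <= 2 * eps k * t k) ->
    (t (f a))^-1 *: (x (f a) - X z0) @[a --> \oo] --> w *m Y.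
  move=> XY xX; have XYf := has_jac_cvg XY tf df.
  have rest0 : (t (f a))^-1 *: (X (z (f a)) - x (f a)) @[a --> \oo] --> (0 : 'rV[R]_K).
    apply: (cvg_enorm_le epsf) => a.
    rewrite subr0 enormZ gtr0_norm ?invr_gt0//.
    by rewrite ler_pdivrMl// mulrC; exact: xX.
  have splitE a : (t (f a))^-1 *: (x (f a) - X z0) =
      (t (f a))^-1 *: (X (z0 + t (f a) *: d (f a)) - X z0)
      - (t (f a))^-1 *: (X (z (f a)) - x (f a)).
    by rewrite tdE -scalerBr opprB [X in _ = _ *: X]addrC addrA subrK.
  rewrite (eq_cvg _ _ splitE) -[w *m Y]subr0.
  by apply: cvgB.
have dirP K (X : 'rV[R]_n -> 'rV[R]_K) Y Z (x v : nat -> 'rV[R]_K) v0 :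
    has_jac X z0 Y -> (forall k, enorm (X (z k) - x k) <= 2 * eps k * t k) ->
    (forall k, regular_normal_cone Z (x k) (v k)) ->
    v (f a) @[a --> \oo] --> v0 -> dir_normal_cone Z (X z0) (w *m Y) v0.
  move=> XY xX xv vv0.
  exists (fun a => t (f a)), (fun a => (t (f a))^-1 *: (x (f a) - X z0)), (fun a => v (f a)).
  split => // [|a]; first exact: quotient_cvg.
  by rewrite scalerA mulfV ?gt_eqF// scale1r addrC subrK.
have zf : z (f a) @[a --> \oo] --> z0.
  by apply: (cvg_enorm_le epsf) => a; exact: ltW.
have w1 : enorm w = 1.
  have dfw : enorm (d (f a)) @[a --> \oo] --> enorm w by exact: cvg_enorm.
  move: dfw; rewrite (eq_cvg _ _ (fun a => d1 (f a))) => dfw.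
  by rewrite -(cvg_lim (@Rhausdorff R) dfw) (lim_cst (@Rhausdorff R)).
(* The normalization survives in the limit and will contradict the vanishing of all [l i]. *)
have lam_sum : \sum_i enorm (l i) ^+ 2 = 1.
  have lam_cvg : \sum_i enorm (lam i (f a)) ^+ 2 @[a --> \oo] --> \sum_i enorm (l i) ^+ 2.
    apply: cvg_big => [|i _]; first exact: add_continuous.
    by rewrite expr2; apply: cvgM; exact: cvg_enorm.
  move: lam_cvg; rewrite (eq_cvg _ _ (fun a => lam1 (f a))) => lam_cvg.
  by rewrite -(cvg_lim (@Rhausdorff R) lam_cvg) (lim_cst (@Rhausdorff R)).
have stat0 : m *m (A z0)^T + \sum_i l i *m (B i z0)^T = 0.
  apply: enorm_eq0; apply/eqP; rewrite eq_le enorm_ge0 andbT.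
  have [_ cA _] := P_C1.
  have stat_cvg : mu (f a) *m (A (z (f a)))^T + \sum_i lam i (f a) *m (B i (z (f a)))^T
      @[a --> \oo] --> m *m (A z0)^T + \sum_i l i *m (B i z0)^T.
    apply: cvgD.
      by apply: cvg_mulmx => //; apply: cvg_trmx; exact: (cvg_comp _ _ zf (cA z0)).
    apply: cvg_big => [|i _]; first exact: add_continuous.
    have [_ cB _] := Q_C1 i.
    by apply: cvg_mulmx => //; apply: cvg_trmx; exact: (cvg_comp _ _ zf (cB z0)).
  apply: (ler_cvg_to (cvg_enorm stat_cvg) epsf).
  by near=> a; exact: stat.
have l0 : forall i, l i = 0.
  apply: (nodir w m l).
  - by apply: contraTneq isT => w0; move: w1; rewrite w0 enorm0 => /esym/eqP; rewrite oner_eq0.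
  - by have [_ _ PA] := P_C1; apply: dirP (PA z0) Pp p_mu muf.
  - move=> i; have [_ _ QB] := Q_C1 i.
    by apply: dirP (QB z0) (Qq i) (q_lam i) (lamf i).
  - exact: stat0.
move: lam_sum; rewrite big1 => [|i _]; last by rewrite l0 enorm0 expr0n.
by move=> /esym/eqP; rewrite oner_eq0.
Unshelve. all: by end_near. Qed.

End DirectionalErrorBound.

(** * Complementarity constraints *)

Section ConstraintSets.
Context {R : realType}.

Lemma closed_preimage_le (T : topologicalType) (f : T -> R) :
  continuous f -> closed [set x | f x <= 0].
Proof. by move=> /continuous_closedP/(_ _ (@closed_le R 0)). Qed.

Lemma closed_preimage_eq (T : topologicalType) (f : T -> R) :
  continuous f -> closed [set x | f x = 0].
Proof. by move=> /continuous_closedP/(_ _ (@closed_eq R 0)). Qed.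

Lemma dotv_lrsubmx_continuous k :
  continuous (fun x : 'rV[R]_(k + k) => dotv (lsubmx x) (rsubmx x)).
Proof.
move=> x; apply: (@cvg_dotv _ _ (nbhs x)).
  exact: continuous_lsubmx.
exact: continuous_rsubmx.
Qed.

Lemma closed_soc k : closed (@soc R k).
Proof.
have -> : @soc R k = [set x | enorm (col' ord0 x) - x 0 ord0 <= 0].
  by apply/seteqP; split => x /=; rewrite /soc/= subr_le0.
apply: closed_preimage_le => x; apply: (@cvgB _ _ _ (nbhs x) _).
  apply: (@cvg_enorm _ _ (nbhs x)); apply: (@cvg_mx _ _ (nbhs x)) => i j.
  rewrite mxE; under eq_cvg do rewrite mxE.
  exact: coord_continuous.
exact: coord_continuous.
Qed.

Lemma closed_Omega k : closed (@Omega R k).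
Proof.
have -> : @Omega R k = lsubmx @^-1` (@soc R k) `&` rsubmx @^-1` (@soc R k)
    `&` [set w | dotv (lsubmx w) (rsubmx w) = 0].
  by apply/seteqP; split => x /= => [[? ? ?]|[[? ?] ?]].
apply: closedI; last exact: closed_preimage_eq (@dotv_lrsubmx_continuous _).
apply: closedI.
  exact: (iffLR (continuous_closedP _) (@continuous_lsubmx _ _ _ _) _ (@closed_soc k)).
exact: (iffLR (continuous_closedP _) (@continuous_rsubmx _ _ _ _) _ (@closed_soc k)).
Qed.

Lemma closed_nonposv N : closed (@nonposv R N).
Proof.
have -> : @nonposv R N = \bigcap_j [set x | x 0 j <= 0].
  by apply/seteqP; split => x /= H j; [move=> _|]; exact: H.
apply: closed_bigI => j _; apply: closed_preimage_le; exact: coord_continuous.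
Qed.

Lemma closed_nonnegv N : closed (@nonnegv R N).
Proof.
have -> : @nonnegv R N = \bigcap_j [set x | - x 0 j <= 0].
  apply/seteqP; split => x /= H j; first by move=> _; rewrite /= oppr_le0.
  by have := H j I; rewrite /= oppr_le0.
apply: closed_bigI => j _; apply: closed_preimage_le => x.
by apply: (@cvgN _ _ _ (nbhs x) _); exact: coord_continuous.
Qed.

Lemma closed_Theta s : closed (@Theta R s).
Proof.
have -> : @Theta R s = lsubmx @^-1` (@nonnegv R s) `&` rsubmx @^-1` (@nonnegv R s)
    `&` [set w | dotv (lsubmx w) (rsubmx w) = 0].
  by apply/seteqP; split => x /= => [[? ? ?]|[[? ?] ?]].
apply: closedI; last exact: closed_preimage_eq (@dotv_lrsubmx_continuous _).
apply: closedI.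
  exact: (iffLR (continuous_closedP _) (@continuous_lsubmx _ _ _ _) _ (@closed_nonnegv s)).
exact: (iffLR (continuous_closedP _) (@continuous_rsubmx _ _ _ _) _ (@closed_nonnegv s)).
Qed.

Lemma compl_setP p q s (a : 'rV[R]_p) (b : 'rV[R]_q) (c d : 'rV[R]_s) :
  compl_set (row_mx a (row_mx b (row_mx c d))) <->
  [/\ nonposv a, b = 0 & Theta (row_mx c d)].
Proof. by rewrite /compl_set/= !row_mxKl !row_mxKr row_mxKl. Qed.

Lemma ThetaP s (c d : 'rV[R]_s) :
  Theta (row_mx c d) <-> forall i, [/\ 0 <= c 0 i, 0 <= d 0 i & c 0 i * d 0 i = 0].
Proof.
rewrite /Theta/= row_mxKl row_mxKr; split=> [[c0 d0 cd] i|H].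
  split; [exact: c0|exact: d0|apply/eqP].
  move/eqP: cd; rewrite psumr_eq0 => [/allP/(_ i (mem_index_enum _))//|j _].
  by rewrite mulr_ge0; [|exact: c0|exact: d0].
split => [i|i|]; [by have [] := H i|by have [] := H i|].
by apply: big1 => i _; have [] := H i.
Qed.

Lemma closed_compl_set p q s : closed (@compl_set R p q s).
Proof.
have -> : @compl_set R p q s = lsubmx @^-1` (@nonposv R p)
    `&` rsubmx @^-1` (lsubmx @^-1` [set 0] `&` rsubmx @^-1` (@Theta R s)).
  by apply/seteqP; split => x /= => [[? ? ?]|[? [? ?]]].
have closed_l m n1 n2 (A : set 'M[R]_(m, n1)) :
    closed A -> closed ((@lsubmx R m n1 n2) @^-1` A).
  exact: (iffLR (continuous_closedP _) (@continuous_lsubmx _ _ _ _)).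
have closed_r m n1 n2 (A : set 'M[R]_(m, n2)) :
    closed A -> closed ((@rsubmx R m n1 n2) @^-1` A).
  exact: (iffLR (continuous_closedP _) (@continuous_rsubmx _ _ _ _)).
apply: closedI; first by apply: (closed_l); exact: closed_nonposv.
apply: (closed_r); apply: closedI; last by apply: (closed_r); exact: closed_Theta.
apply: (closed_l); apply: accessible_closed_set1; apply: hausdorff_accessible.
exact: norm_hausdorff.
Qed.

(** The product of the first coordinates dominates that of the tail norms, and Cauchy-Schwarz
    concludes. Consequently a zero sum of block products vanishes block by block. *)
Lemma soc_dotv_ge0 k (x y : 'rV[R]_k.+1) : soc x -> soc y -> 0 <= dotv x y.
Proof.
move=> xK yK; have -> : dotv x y = x 0 ord0 * y 0 ord0 + dotv (col' ord0 x) (col' ord0 y).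
  rewrite /dotv big_ord_recl; congr (_ + _); apply: eq_bigr => j _.
  by rewrite !mxE.
have := ler_norm_dotv (col' ord0 x) (col' ord0 y); rewrite ler_norml => /andP[+ _].
have := ler_pM (enorm_ge0 _) (enorm_ge0 _) xK yK; lra.
Qed.

End ConstraintSets.

(** * Regular and directional normals to the complementarity set *)

Section ComplementarityNormals.
Context {R : realType}.

(** Testing along coordinate segments contained in the set suffices. At a biactive pair both
    half-axes are available, hence the two nonpositive signs. *)
Lemma regular_normal_compl_set p q s (a la : 'rV[R]_p) (b lb : 'rV[R]_q)
    (c d lc ld : 'rV[R]_s) :
  regular_normal_cone (@compl_set R p q s) (row_mx a (row_mx b (row_mx c d)))
    (row_mx la (row_mx lb (row_mx lc ld))) ->
  [/\ [/\ nonposv a, b = 0 & forall i, [/\ 0 <= c 0 i, 0 <= d 0 i & c 0 i * d 0 i = 0]],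
      forall i, 0 <= la 0 i /\ (a 0 i < 0 -> la 0 i = 0) &
      forall i, [/\ 0 < c 0 i -> lc 0 i = 0, 0 < d 0 i -> ld 0 i = 0 &
                    c 0 i = 0 -> d 0 i = 0 -> lc 0 i <= 0 /\ ld 0 i <= 0]].
Proof.
move=> lN; have [/compl_setP[a0 b0 /ThetaP cd] _] := lN.
(* Test directions keep the equality block at 0, so [lb] stays free. The final [True] only pads the
   conjunction. *)
have dir (u : 'rV[R]_p) (v w : 'rV[R]_s) r : 0 < r ->
    (forall t, 0 < t < r -> [/\ nonposv (a + t *: u),
      forall i, [/\ 0 <= c 0 i + t * v 0 i, 0 <= d 0 i + t * w 0 i &
                    (c 0 i + t * v 0 i) * (d 0 i + t * w 0 i) = 0] & True]) ->
    dotv la u + dotv lc v + dotv ld w <= 0.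
  move=> r0 H; have := @regular_normal_dir _ _ _ _ _
    (row_mx u (row_mx 0 (row_mx v w))) r lN r0.
  rewrite !dotv_row_mx dotv0 add0r addrA; apply => t /H[au cv _].
  rewrite !scale_row_mx !add_row_mx; apply/compl_setP; split => //.
    by rewrite b0 scaler0 addr0.
  by apply/ThetaP => i; rewrite !mxE; exact: cv.
split; first by split.
- move=> i; suff la0 : 0 <= la 0 i; first split=> // ai.
    apply/eqP; rewrite eq_le la0 andbT.
    (* The segment may be as long as the slack [- a 0 i] of the inactive inequality. *)
    have := dir (delta_mx 0 i) 0 0 (- a 0 i); rewrite oppr_gt0 !dotv0 !addr0 dotv_delta.
    apply=> // t /andP[t0 tr]; split => // [j|j]; last by rewrite !mxE !mulr0 !addr0.
    rewrite !mxE eqxx/=; have [->|ji] := eqVneq j i; first by rewrite mulr1; lra.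
    by rewrite mulr0 addr0; exact: a0.
  have := dir (- delta_mx 0 i) 0 0 1 ltr01; rewrite !dotv0 !addr0 dotvNr dotv_delta oppr_le0.
  apply => t /andP[t0 _]; split => // [j|j]; last by rewrite !mxE !mulr0 !addr0.
  have := a0 j; rewrite !mxE eqxx/= => aj.
  by rewrite mulrN (le_trans _ aj)// gerBl mulr_ge0// ltW.
(* While [d 0 i = 0], the coordinate [c 0 i] may move as long as it is nonnegative: upwards always
   ([e = 1]), downwards ([e = -1]) up to the length [c 0 i] when it is positive. *)
have move_c i e r : 0 < r -> d 0 i = 0 -> (forall t, 0 < t < r -> 0 <= c 0 i + t * e) ->
    lc 0 i * e <= 0.
  move=> r0 di H; have := dir 0 (e *: delta_mx 0 i) 0 r r0.
  rewrite !dotv0 !addr0 add0r dotvZr dotv_delta mulrC; apply => t tr.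
  split => // [j|j]; first by rewrite scaler0 addr0; exact: a0.
  rewrite !mxE eqxx/= mulr0 addr0; have [->|ji] := eqVneq j i.
    by rewrite mulr1 di mulr0; split => //; exact: H.
  by rewrite !mulr0 addr0; exact: cd.
have move_d i e r : 0 < r -> c 0 i = 0 -> (forall t, 0 < t < r -> 0 <= d 0 i + t * e) ->
    ld 0 i * e <= 0.
  move=> r0 ci H; have := dir 0 0 (e *: delta_mx 0 i) r r0.
  rewrite !dotv0 !add0r dotvZr dotv_delta mulrC; apply => t tr.
  split => // [j|j]; first by rewrite scaler0 addr0; exact: a0.
  rewrite !mxE eqxx/= mulr0 addr0; have [->|ji] := eqVneq j i.
    by rewrite mulr1 ci mul0r; split => //; exact: H.
  by rewrite !mulr0 addr0; exact: cd.
move=> i; have [ci0 di0 cdi] := cd i; split => [ci|di|ci di].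
- have di : d 0 i = 0 by move/eqP: cdi; rewrite mulf_eq0 gt_eqF//= => /eqP.
  have := move_c i 1 1 ltr01 di; have := move_c i (-1) (c 0 i) ci di.
  rewrite mulrN1 oppr_le0 mulr1 => lc1 lc2; apply/eqP; rewrite eq_le lc1 ?lc2//.
    by move=> t /andP[t0 _]; lra.
  by move=> t /andP[t0 tc]; lra.
- have ci : c 0 i = 0 by move/eqP: cdi; rewrite mulf_eq0 (gt_eqF di) orbF => /eqP.
  have := move_d i 1 1 ltr01 ci; have := move_d i (-1) (d 0 i) di ci.
  rewrite mulrN1 oppr_le0 mulr1 => ld1 ld2; apply/eqP; rewrite eq_le ld1 ?ld2//.
    by move=> t /andP[t0 _]; lra.
  by move=> t /andP[t0 tc]; lra.
split; rewrite -[_ 0 i]mulr1.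
  by apply: (move_c i 1 1) => // t /andP[t0 _]; lra.
by apply: (move_d i 1 1) => // t /andP[t0 _]; lra.
Qed.

Lemma near_cst_lim (u : nat -> R) (l e : R) :
  u @ \oo --> l -> (\forall k \near \oo, u k = e) -> l = e.
Proof.
move=> ul ue; apply/eqP; rewrite eq_le; apply/andP; split.
  by apply: (cvgr_to_le ul); apply: filterS ue => k ->.
by apply: (cvgr_to_ge ul); apply: filterS ue => k ->.
Qed.

Lemma cvg_along (t e : nat -> R) (a l : R) :
  decreases_to0 t -> e @ \oo --> l -> a + t k * e k @[k --> \oo] --> a.
Proof.
move=> [_ t0] el; have -> : a = a + 0 * l by rewrite mul0r addr0.
rewrite {1}mul0r addr0; apply: cvgD; first exact: cvg_cst.
exact: cvgM.
Qed.

(* The union of [u v = 0] and [u, v <= 0] is closed, so the alternatives that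
   hold along the sequence survive in the limit: this is what yields M-type
   rather than merely weak multipliers. *)
Lemma Theta_normal_limit (t x y u v : nat -> R) (x0 y0 u0 v0 : R) :
  decreases_to0 t -> x @ \oo --> x0 -> y @ \oo --> y0 ->
  u @ \oo --> u0 -> v @ \oo --> v0 ->
  (forall k, [/\ 0 <= t k * x k, 0 <= t k * y k & (t k * x k) * (t k * y k) = 0]) ->
  (forall k, [/\ 0 < t k * x k -> u k = 0, 0 < t k * y k -> v k = 0 &
     t k * x k = 0 -> t k * y k = 0 -> u k <= 0 /\ v k <= 0]) ->
  [/\ 0 <= x0, 0 <= y0 & x0 * y0 = 0] /\ normal_Theta x0 y0 (u0, v0).
Proof.
move=> [t0 _] xx yy uu vv txy tuv.
have xy k : [/\ 0 <= x k, 0 <= y k & x k * y k = 0].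
  have [] := txy k; rewrite !pmulr_rge0// => -> -> /eqP.
  by rewrite mulf_eq0 !(mulf_eq0 (t k)) gt_eqF//= -mulf_eq0 => /eqP.
have uv k : [/\ 0 < x k -> u k = 0, 0 < y k -> v k = 0 &
    x k = 0 -> y k = 0 -> u k <= 0 /\ v k <= 0].
  have [] := tuv k; rewrite !pmulr_rgt0// => ? ? H; split=> // xk yk.
  by apply: H; rewrite ?xk ?yk mulr0.
have x_ge0 : 0 <= x0 by apply: (cvgr_to_ge xx); apply: nearW => k; have [] := xy k.
have y_ge0 : 0 <= y0 by apply: (cvgr_to_ge yy); apply: nearW => k; have [] := xy k.
have xy0 : x0 * y0 = 0.
  by apply: (near_cst_lim (cvgM xx yy)); apply: nearW => k; have [] := xy k.
have ge0_neq0 (a : R) : 0 <= a -> a != 0 -> 0 < a by move=> ? ?; rewrite lt_def; apply/andP.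
have alt k : u k * v k = 0 \/ (u k <= 0 /\ v k <= 0).
  have [x_k y_k _] := xy k; have [ux vy H] := uv k.
  have [xk|/(ge0_neq0 _ x_k)/ux ->] := eqVneq (x k) 0; last by left; rewrite mul0r.
  have [yk|/(ge0_neq0 _ y_k)/vy ->] := eqVneq (y k) 0; last by left; rewrite mulr0.
  by right; exact: H.
split=> //; split => /=.
- rewrite /vec2; apply/ThetaP => i; rewrite !mxE ord1 eqxx !mulr1n.
  by split.
- move=> x_gt0; apply: (near_cst_lim uu); apply: filterS (cvgr_gt _ xx _ x_gt0) => k.
  by have [] := uv k.
- move=> y_gt0; apply: (near_cst_lim vv); apply: filterS (cvgr_gt _ yy _ y_gt0) => k.
  by have [] := uv k.
move=> _ _.
(* A positive limit eventually rules out the alternative [u k <= 0], leaving [u k * v k = 0] with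
   [u k > 0]. *)
have upos : 0 < u0 -> v0 = 0.
  move=> u_gt0; apply: (near_cst_lim vv); apply: filterS (cvgr_gt _ uu _ u_gt0) => k uk.
  have [/eqP|[ukle0 _]] := alt k; last by move: uk; rewrite ltNge ukle0.
  by rewrite mulf_eq0 gt_eqF//= => /eqP.
have vpos : 0 < v0 -> u0 = 0.
  move=> v_gt0; apply: (near_cst_lim uu); apply: filterS (cvgr_gt _ vv _ v_gt0) => k vk.
  have [/eqP|[_ vkle0]] := alt k; last by move: vk; rewrite ltNge vkle0.
  by rewrite mulf_eq0 (gt_eqF vk) orbF => /eqP.
case: (ltgtP u0 0) => [u_lt0|/upos ->|->]; [|by right; rewrite mulr0|by right; rewrite mul0r].
case: (ltgtP v0 0) => [v_lt0|/vpos ->|->]; [by left|by right; rewrite mul0r|by right; rewrite mulr0].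
Qed.

(** Strict inequalities at the base point persist along the sequence because [t k] tends to 0, so
    the complementary coordinate and the multiplier concerned are eventually zero. At a biactive
    pair the base values vanish and the planar limit argument applies. The conditions on the
    direction are recorded too, as they place [w] in the linearized cone. *)
Lemma dir_normal_compl_set p q s (a da la : 'rV[R]_p) (b db lb : 'rV[R]_q)
    (c d dc dd lc ld : 'rV[R]_s) :
  compl_set (row_mx a (row_mx b (row_mx c d))) ->
  dir_normal_cone (@compl_set R p q s) (row_mx a (row_mx b (row_mx c d)))
    (row_mx da (row_mx db (row_mx dc dd))) (row_mx la (row_mx lb (row_mx lc ld))) ->
  [/\ [/\ forall i, a 0 i = 0 -> da 0 i <= 0, db = 0,
          forall i, d 0 i <> 0 -> dc 0 i = 0 & forall i, c 0 i <> 0 -> dd 0 i = 0],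
      [/\ nonnegv la, forall i, a 0 i <> 0 -> la 0 i = 0,
          forall i, c 0 i <> 0 -> lc 0 i = 0 & forall i, d 0 i <> 0 -> ld 0 i = 0] &
      forall i, c 0 i = 0 -> d 0 i = 0 ->
        [/\ 0 <= dc 0 i, 0 <= dd 0 i & dc 0 i * dd 0 i = 0] /\
        normal_Theta (dc 0 i) (dd 0 i) (lc 0 i, ld 0 i)].
Proof.
move=> /compl_setP[a0 b0 /ThetaP cd] [t [e [v [t0 ecvg vcvg ev]]]].
pose ea k := lsubmx (e k); pose eb k := lsubmx (rsubmx (e k)).
pose ec k := lsubmx (rsubmx (rsubmx (e k))); pose ed k := rsubmx (rsubmx (rsubmx (e k))).
pose va k := lsubmx (v k); pose vc k := lsubmx (rsubmx (rsubmx (v k))).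
pose vd k := rsubmx (rsubmx (rsubmx (v k))).
have eE k : e k = row_mx (ea k) (row_mx (eb k) (row_mx (ec k) (ed k))) by rewrite !hsubmxK.
have vE k : v k = row_mx (va k) (row_mx (lsubmx (rsubmx (v k))) (row_mx (vc k) (vd k))).
  by rewrite !hsubmxK.
have {ev}ev k : regular_normal_cone (@compl_set R p q s)
    (row_mx (a + t k *: ea k) (row_mx (b + t k *: eb k)
      (row_mx (c + t k *: ec k) (d + t k *: ed k))))
    (row_mx (va k) (row_mx (lsubmx (rsubmx (v k))) (row_mx (vc k) (vd k)))).
  by have := ev k; rewrite -vE {1}eE !scale_row_mx !add_row_mx.
have parts k := regular_normal_compl_set (ev k).
have cvg_l m n1 n2 (x : nat -> 'M[R]_(m, n1 + n2))
    (y1 : 'M[R]_(m, n1)) (y2 : 'M[R]_(m, n2)) :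
    x @ \oo --> row_mx y1 y2 -> lsubmx (x k) @[k --> \oo] --> y1.
  move=> xy; apply: cvg_mx => i j; rewrite -(row_mxEl y1 y2).
  by under eq_cvg do rewrite mxE; exact: cvg_coord.
have cvg_r m n1 n2 (x : nat -> 'M[R]_(m, n1 + n2))
    (y1 : 'M[R]_(m, n1)) (y2 : 'M[R]_(m, n2)) :
    x @ \oo --> row_mx y1 y2 -> rsubmx (x k) @[k --> \oo] --> y2.
  move=> xy; apply: cvg_mx => i j; rewrite -(row_mxEr y1 y2).
  by under eq_cvg do rewrite mxE; exact: cvg_coord.
have ea_da i : ea k 0 i @[k --> \oo] --> da 0 i.
  exact/cvg_coord/(cvg_l _ _ _ _ _ _ ecvg).
have va_la i : va k 0 i @[k --> \oo] --> la 0 i.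
  exact/cvg_coord/(cvg_l _ _ _ _ _ _ vcvg).
have e1 := cvg_r _ _ _ _ _ _ ecvg; have e2 := cvg_r _ _ _ _ _ _ e1.
have v1 := cvg_r _ _ _ _ _ _ vcvg; have v2 := cvg_r _ _ _ _ _ _ v1.
have eb_db i : eb k 0 i @[k --> \oo] --> db 0 i.
  exact/cvg_coord/(cvg_l _ _ _ _ _ _ e1).
have ec_dc i : ec k 0 i @[k --> \oo] --> dc 0 i.
  exact/cvg_coord/(cvg_l _ _ _ _ _ _ e2).
have ed_dd i : ed k 0 i @[k --> \oo] --> dd 0 i.
  exact/cvg_coord/(cvg_r _ _ _ _ _ _ e2).
have vc_lc i : vc k 0 i @[k --> \oo] --> lc 0 i.
  exact/cvg_coord/(cvg_l _ _ _ _ _ _ v2).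
have vd_ld i : vd k 0 i @[k --> \oo] --> ld 0 i.
  exact/cvg_coord/(cvg_r _ _ _ _ _ _ v2).
clearbody ea eb ec ed va vc vd.
have pa k i : [/\ a 0 i + t k * ea k 0 i <= 0, 0 <= va k 0 i &
    a 0 i + t k * ea k 0 i < 0 -> va k 0 i = 0].
  have [[+ _ _] /(_ i)[? +] _] := parts k => /(_ i); by rewrite !mxE.
have pb k : t k *: eb k = 0.
  by have [[_ + _] _ _] := parts k; rewrite b0 add0r.
have pc k i : [/\ 0 <= c 0 i + t k * ec k 0 i, 0 <= d 0 i + t k * ed k 0 i &
    (c 0 i + t k * ec k 0 i) * (d 0 i + t k * ed k 0 i) = 0].
  by have [[_ _ /(_ i)+] _ _] := parts k; rewrite !mxE.
have pv k i : [/\ 0 < c 0 i + t k * ec k 0 i -> vc k 0 i = 0,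
    0 < d 0 i + t k * ed k 0 i -> vd k 0 i = 0 &
    c 0 i + t k * ec k 0 i = 0 -> d 0 i + t k * ed k 0 i = 0 ->
      vc k 0 i <= 0 /\ vd k 0 i <= 0].
  by have [_ _ /(_ i)] := parts k; rewrite !mxE.
have [tpos _] := t0.
have pos (x : R) : 0 <= x -> x <> 0 -> 0 < x by move=> ? /eqP ?; rewrite lt_def; apply/andP.
have c_gt0 i : c 0 i <> 0 -> 0 < c 0 i by apply: pos; have [] := cd i.
have d_gt0 i : d 0 i <> 0 -> 0 < d 0 i by apply: pos; have [] := cd i.
have near_c i : c 0 i <> 0 -> \forall k \near \oo, 0 < c 0 i + t k * ec k 0 i.
  by move=> /c_gt0 ci; exact: (cvgr_gt _ (cvg_along (a := c 0 i) t0 (ec_dc i)) _ ci).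
have near_d i : d 0 i <> 0 -> \forall k \near \oo, 0 < d 0 i + t k * ed k 0 i.
  by move=> /d_gt0 di; exact: (cvgr_gt _ (cvg_along (a := d 0 i) t0 (ed_dd i)) _ di).
split; [split=> [i ai||i di|i ci]|split=> [i|i ai|i ci|i di]|move=> i ci di].
- apply: (cvgr_to_le (ea_da i)); apply: nearW => k.
  by have [+ _ _] := pa k i; rewrite ai add0r pmulr_rle0.
- apply/rowP => i; rewrite mxE; apply: (near_cst_lim (eb_db i)); apply: nearW => k.
  have /eqP := pb k; rewrite scaler_eq0 gt_eqF//= => /eqP ->.
  by rewrite mxE.
- have ci : c 0 i = 0.
    by have [_ _ /eqP] := cd i; rewrite mulf_eq0 => /orP[/eqP//|/eqP/di].
  apply: (near_cst_lim (ec_dc i)); apply: filterS (near_d i di) => k dk.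
  have [_ _ /eqP] := pc k i.
  by rewrite ci add0r mulf_eq0 (gt_eqF dk) orbF mulf_eq0 gt_eqF//= => /eqP.
- have di : d 0 i = 0.
    by have [_ _ /eqP] := cd i; rewrite mulf_eq0 => /orP[/eqP/ci|/eqP].
  apply: (near_cst_lim (ed_dd i)); apply: filterS (near_c i ci) => k ck.
  have [_ _ /eqP] := pc k i.
  by rewrite di add0r mulf_eq0 (gt_eqF ck) mulf_eq0 gt_eqF//= => /eqP.
- by apply: (cvgr_to_ge (va_la i)); apply: nearW => k; have [] := pa k i.
- have a_lt0 : a 0 i < 0 by rewrite lt_neqAle a0 andbT; apply/eqP.
  apply: (near_cst_lim (va_la i)).
  apply: filterS (cvgr_lt _ (cvg_along (a := a 0 i) t0 (ea_da i)) _ a_lt0) => k.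
  by have [] := pa k i.
- apply: (near_cst_lim (vc_lc i)); apply: filterS (near_c i ci) => k.
  by have [] := pv k i.
- apply: (near_cst_lim (vd_ld i)); apply: filterS (near_d i di) => k.
  by have [] := pv k i.
apply: (Theta_normal_limit t0 (ec_dc i) (ed_dd i) (vc_lc i) (vd_ld i)) => k.
  by have := pc k i; rewrite ci di !add0r.
by have := pv k i; rewrite ci di !add0r.
Qed.

End ComplementarityNormals.

(** * From the concrete complementarity system to the abstract one *)

Section ResidualComparison.
Context {R : realType}.

(** Regrouping coordinates in pairs turns the left side into the Euclidean norm of the vector of
    planar norms, which is at most their sum. *)
Lemma enorm_row_mx_le N (x y : 'rV[R]_N) :
  enorm (row_mx x y) <= \sum_i enorm (vec2 (x 0 i) (y 0 i)).
Proof.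
have -> : enorm (row_mx x y) = enorm (\row_i enorm (vec2 (x 0 i) (y 0 i))).
  rewrite /enorm; congr Num.sqrt; rewrite dotv_row_mx -big_split/=.
  apply: eq_bigr => i _; rewrite !mxE -(expr2 (enorm _)) sqr_enorm dotv_row_mx /dotv !big_ord1.
  by rewrite !mxE eqxx !mulr1n.
rewrite (le_trans (ler_enorm_sum _))//; apply: ler_sum => i _.
by rewrite mxE ger0_norm// enorm_ge0.
Qed.

(** The competitor is built blockwise: [a - posv a], which is the negative part, then [0], then the
    planar projections of the pairs on [Theta 1]. *)
Lemma edistance_compl_set p q s (a : 'rV[R]_p) (b : 'rV[R]_q) (c d : 'rV[R]_s) :
  edistance (row_mx a (row_mx b (row_mx c d))) (@compl_set R p q s) <=
  enorm b + enorm (posv a)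
  + \sum_(i < s) edistance (vec2 (c 0 i) (d 0 i)) (@Theta R 1).
Proof.
have Theta0 : @Theta R 1 !=set0.
  exists (vec2 0 0); apply/ThetaP => i.
  by rewrite !mxE ord1 eqxx !mulr1n mulr0.
have proj i : {xy : R * R | Theta (vec2 xy.1 xy.2) /\
    edistance (vec2 (c 0 i) (d 0 i)) (@Theta R 1) =
    enorm (vec2 (c 0 i) (d 0 i) - vec2 xy.1 xy.2)}.
  apply: cid; have [w Tw ->] := edistance_attained (vec2 (c 0 i) (d 0 i)) (@closed_Theta R 1) Theta0.
  have wE : w = vec2 (lsubmx w 0 0) (rsubmx w 0 0).
    by rewrite /vec2 -!mx11_scalar hsubmxK.
  by exists (lsubmx w 0 0, rsubmx w 0 0); rewrite -wE.
pose x i := (sval (proj i)).1; pose y i := (sval (proj i)).2.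
have xyT i : Theta (vec2 (x i) (y i)) by have [] := svalP (proj i).
have xyd i : edistance (vec2 (c 0 i) (d 0 i)) (@Theta R 1) =
    enorm (vec2 (c 0 i - x i) (d 0 i - y i)).
  have [_ ->] := svalP (proj i); congr enorm.
  by rewrite /vec2 opp_row_mx add_row_mx !raddfB.
clearbody x y.
have : compl_set (row_mx (a - posv a) (row_mx (0 : 'rV[R]_q) (row_mx (\row_i x i) (\row_i y i)))).
  apply/compl_setP; split => //.
    by move=> i; rewrite !mxE subr_le0 le_max lexx orbT.
  apply/ThetaP => i; rewrite !mxE.
  by have /ThetaP/(_ ord0) := xyT i; rewrite !mxE eqxx !mulr1n.
move=> /(edistance_le (row_mx a (row_mx b (row_mx c d)))) /le_trans -> //.
rewrite !opp_row_mx !add_row_mx subr0 subKr.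
rewrite (le_trans (enorm_row_mx _ _))// -addrA addrCA lerD2l.
rewrite (le_trans (enorm_row_mx _ _))// lerD2l.
rewrite (le_trans (enorm_row_mx_le _ _))//; apply: ler_sum => i _.
by rewrite xyd !mxE.
Qed.

(** Regular normal cones are empty off [C], so the points carrying the normals belong to [C]. *)
Lemma dir_normal_tangent N (C : set 'rV[R]_N) z d v :
  dir_normal_cone C z d v -> tangent_cone C z d.
Proof.
move=> [t [d_ [v_ [t0 dd _ H]]]]; exists t, d_; split => // k.
by have [] := H k.
Qed.

(** The feasible set has one orthogonality equation for all blocks, the abstract system one per
    block; they agree because the block products are nonnegative on the cones. *)
Lemma feasible_set_system n p q s J (k : 'I_J -> nat)
    (g : 'rV[R]_n -> 'rV[R]_p) (h : 'rV[R]_n -> 'rV[R]_q)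
    (phi psi : 'rV[R]_n -> 'rV[R]_s)
    (G H : forall i : 'I_J, 'rV[R]_n -> 'rV[R]_(k i).+1) :
  feasible_set g h phi psi G H =
  system_solutions (compl_map g h phi psi) (fun i z => row_mx (G i z) (H i z))
    (@compl_set R p q s) (fun i => @Omega R (k i)).
Proof.
apply/seteqP; split => z.
  move=> [[Gz Hz GH] gz hz [phiz psiz pp]]; split.
    by apply/compl_setP; split => //; rewrite /Theta/= row_mxKl row_mxKr.
  move=> i; rewrite /Omega/= row_mxKl row_mxKr; split => //.
  move/eqP: GH; rewrite psumr_eq0 => [/allP/(_ i (mem_index_enum _))/eqP//|j _].
  exact: soc_dotv_ge0.
move=> [/compl_setP[gz hz]]; rewrite /Theta/= row_mxKl row_mxKr => -[? ? ?] OGH.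
have {}OGH i : [/\ soc (G i z), soc (H i z) & dotv (G i z) (H i z) = 0].
  by have := OGH i; rewrite /Omega/= row_mxKl row_mxKr.
split => //; split => [i|i|]; [by have [] := OGH i|by have [] := OGH i|].
by apply: big1 => i _; have [] := OGH i.
Qed.

End ResidualComparison.

(* The i-th block has dimension m_i = (k i).+1 >= 1. *)
Theorem theorem7p6 (R : realType) (n p q s J : nat) (k : 'I_J -> nat)
    (g : 'rV[R]_n -> 'rV[R]_p) (h : 'rV[R]_n -> 'rV[R]_q)
    (phi psi : 'rV[R]_n -> 'rV[R]_s)
    (G H : forall i : 'I_J, 'rV[R]_n -> 'rV[R]_(k i).+1)
    (g_C1 : continuously_differentiable g)
    (h_C1 : continuously_differentiable h)
    (phi_C1 : continuously_differentiable phi)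
    (psi_C1 : continuously_differentiable psi)
    (G_C1 : forall i, continuously_differentiable (G i))
    (H_C1 : forall i, continuously_differentiable (H i))
    (z0 : 'rV[R]_n)
    (z0_feasible : feasible_set g h phi psi G H z0)
    (compl_subregular : metrically_subregular (compl_map g h phi psi)
                          (@compl_set R p q s) z0)
    (directional_cond :
      linearized_cone g h phi psi G H z0 = [set 0] \/
      (linearized_cone g h phi psi G H z0 <> [set 0] /\
       forall w, w != 0 -> linearized_cone g h phi psi G H z0 w ->
       forall (lg : 'rV[R]_p) (lh : 'rV[R]_q) (lphi lpsi : 'rV[R]_s)
              (lG lH : forall i : 'I_J, 'rV[R]_(k i).+1),
         dir_multiplier g h phi psi G H z0 w lg lh lphi lpsi lG lH ->
         (forall i, lG i = 0) /\ (forall i, lH i = 0))) :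
  exists kappa delta : R, [/\ 0 < kappa, 0 < delta &
    forall z, eball z0 delta z ->
      edistance z (feasible_set g h phi psi G H) <=
      kappa * (enorm (h z) + enorm (posv (g z))
               + \sum_(i < s) edistance (vec2 (phi z 0 i) (psi z 0 i))
                                        (@Theta R 1)
               + \sum_(i < J) edistance (row_mx (G i z) (H i z))
                                        (@Omega R (k i)))].
Proof.
pose Q i z := row_mx (G i z) (H i z).
pose B i z := row_mx ('J (G i) z) ('J (H i) z).
pose P := compl_map g h phi psi.
pose A z := row_mx ('J g z) (row_mx ('J h z) (row_mx ('J phi z) ('J psi z))).
have P_C1 : C1_with P A.
  by do 3 (apply: C1_with_row_mx; first exact: C1_with_jacobian); exact: C1_with_jacobian.
have Q_C1 i : C1_with (Q i) (B i).
  by apply: C1_with_row_mx; exact: C1_with_jacobian.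
have [Pz0 Qz0] : system_solutions P Q (@compl_set R p q s) (fun i => @Omega R (k i)) z0.
  by rewrite -feasible_set_system.
have [w mu lam w0 muN lamN stat|kappa [delta [kappa0 delta0 EB]]] :=
  directional_error_bound P_C1 Q_C1 (@closed_compl_set R p q s)
    (fun i => @closed_Omega R (k i)) Pz0 Qz0 compl_subregular.
  pose lg := lsubmx mu; pose lh := lsubmx (rsubmx mu).
  pose lphi := lsubmx (rsubmx (rsubmx mu)); pose lpsi := rsubmx (rsubmx (rsubmx mu)).
  have muE : mu = row_mx lg (row_mx lh (row_mx lphi lpsi)) by rewrite !hsubmxK.
  pose lG i := lsubmx (lam i); pose lH i := rsubmx (lam i).
  have lamE i : lam i = row_mx (lG i) (lH i) by rewrite hsubmxK.
  clearbody lg lh lphi lpsi lG lH.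
  have [[dg dh dphi dpsi] [lg0 lgI lphiI lpsiI] biactive] :
      [/\ [/\ forall i, g z0 0 i = 0 -> (w *m 'J g z0) 0 i <= 0, w *m 'J h z0 = 0,
          forall i, psi z0 0 i <> 0 -> (w *m 'J phi z0) 0 i = 0 &
          forall i, phi z0 0 i <> 0 -> (w *m 'J psi z0) 0 i = 0],
      [/\ nonnegv lg, forall i, g z0 0 i <> 0 -> lg 0 i = 0,
          forall i, phi z0 0 i <> 0 -> lphi 0 i = 0 &
          forall i, psi z0 0 i <> 0 -> lpsi 0 i = 0] &
      forall i, phi z0 0 i = 0 -> psi z0 0 i = 0 ->
        [/\ 0 <= (w *m 'J phi z0) 0 i, 0 <= (w *m 'J psi z0) 0 i &
            (w *m 'J phi z0) 0 i * (w *m 'J psi z0) 0 i = 0] /\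
        normal_Theta ((w *m 'J phi z0) 0 i) ((w *m 'J psi z0) 0 i)
          (lphi 0 i, lpsi 0 i)].
    have muN' : dir_normal_cone (@compl_set R p q s)
        (row_mx (g z0) (row_mx (h z0) (row_mx (phi z0) (psi z0))))
        (row_mx (w *m 'J g z0) (row_mx (w *m 'J h z0)
          (row_mx (w *m 'J phi z0) (w *m 'J psi z0))))
        (row_mx lg (row_mx lh (row_mx lphi lpsi))).
      by rewrite -muE -!mul_mx_row.
    exact: (dir_normal_compl_set Pz0 muN').
  have lamO i : dir_normal_cone (@Omega R (k i)) (row_mx (G i z0) (H i z0))
      (row_mx (w *m 'J (G i) z0) (w *m 'J (H i) z0)) (row_mx (lG i) (lH i)).
    by rewrite -lamE -mul_mx_row.
  (* The directional normals at hand already carry the tangency of [w]. *)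
  have Lw : linearized_cone g h phi psi G H z0 w.
    split; split => //.
    - by move=> i; rewrite dh mxE.
    - by move=> i phii psii; have [] := biactive i phii psii.
    - by move=> i; exact: dir_normal_tangent (lamO i).
  (* A trivial linearized cone contradicts [w != 0]. *)
  case: directional_cond => [L0|[_ dc]].
    by move: Lw w0; rewrite L0 /= => ->; rewrite eqxx.
  have [lG0 lH0] : (forall i, lG i = 0) /\ (forall i, lH i = 0).
    apply: (dc w w0 Lw lg lh lphi lpsi lG lH); split; [|by split| |exact: lamO].
      apply: (etrans _ stat).
      rewrite muE /A !tr_row_mx !mul_row_col -!addrA; do 4 congr (_ + _).
      rewrite -big_split/=; apply: eq_bigr => i _.
      by rewrite lamE /B tr_row_mx mul_row_col.
    by move=> i phii psii; have [] := biactive i phii psii.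
  by move=> i; rewrite lamE lG0 lH0 row_mx0.
(* The abstract residual is dominated by the natural one, with the same [kappa]. *)
exists kappa, delta; split => // z /EB; rewrite -feasible_set_system => /le_trans; apply.
by rewrite ler_wpM2l ?(ltW kappa0)// lerD2r; exact: edistance_compl_set.
Qed.
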